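(* Let $p$ be a prime, $n\ge1$ and $1<\rho<\infty$. The space $\Phi(\mathbb{Q}_p^n)$ is dense in $\mathcal{L}^{\rho}(\mathbb{Q}_p^n)$.
   Context: $\mathcal{L}^{\rho}(\mathbb{Q}_p^n)$ is the usual Lebesgue space of complex-valued functions on $\mathbb{Q}_p^n$ with respect to Haar measure $d^nx$ (normalized so that the unit ball has measure $1$). $\mathcal{D}(\mathbb{Q}_p^n)$ is the space of locally constant compactly supported functions $\mathbb{Q}_p^n\to\mathbb{C}$. Fourier transform: $F[\varphi](\xi)=\int_{\mathbb{Q}_p^n}\chi_p(\xi\cdot x)\varphi(x)\,d^nx$, with $\chi_p(\xi\cdot x)=e^{2\pi i\sum_j\{\xi_jx_j\}_p}$, $\{\cdot\}_p$ the $p$-adic fractional part. $\Psi(\mathbb{Q}_p^n)=\{\psi\in\mathcal{D}(\mathbb{Q}_p^n):\psi(0)=0\}$, and the Lizorkin space of test functions of the second kind is $\Phi(\mathbb{Q}_p^n)=\{F[\psi]:\psi\in\Psi(\mathbb{Q}_p^n)\}$. *)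

(* Defs.v *)
From HB Require Import structures.
From mathcomp Require Import all_boot all_order all_algebra generic_quotient.
From mathcomp Require Import ring_quotient archimedean ring lra complex.
From mathcomp Require Import all_classical all_reals all_analysis.

Set Implicit Arguments.
Unset Strict Implicit.
Unset Printing Implicit Defensive.

Import Order.TTheory GRing.Theory Num.Theory.

Local Open Scope classical_set_scope.
Local Open Scope ring_scope.
Local Open Scope quotient_scope.

(* At most one of the two exponents is nonzero. *)
Definition padic_abs (p : nat) (x : rat) : rat :=
  if x == 0 then 0
  else p%:R ^+ logn p `|denq x|%N / p%:R ^+ logn p `|numq x|%N.

Arguments padic_abs p x%_R.

Section PadicAbs.
Variables (p : nat) (p_pr : prime p).
Local Notation "v[ x ]" := (padic_abs p x%R) (at level 0, format "v[ x ]").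
Implicit Types (x y : rat) (a b : int).

Let p0 : p%:R != 0 :> rat.
Proof. by rewrite pnatr_eq0 -lt0n prime_gt0. Qed.

Let pX0 k : p%:R ^+ k != 0 :> rat.
Proof. by rewrite expf_neq0. Qed.

Lemma padic_abs0 : v[0] = 0.
Proof. by rewrite /padic_abs eqxx. Qed.

Lemma padic_abs_gt0 x : x != 0 -> 0 < v[x].
Proof.
move=> x0; rewrite /padic_abs (negPf x0) divr_gt0// exprn_gt0// ltr0n;
exact: prime_gt0.
Qed.

Lemma padic_abs_ge0 x : 0 <= v[x].
Proof.
by have [->|x0] := eqVneq x 0; [rewrite padic_abs0 | exact/ltW/padic_abs_gt0].
Qed.

Lemma padic_abs_eq0 x : (v[x] == 0) = (x == 0).
Proof.
have [->|x0] := eqVneq x 0; first by rewrite padic_abs0 eqxx.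
by rewrite gt_eqF// padic_abs_gt0.
Qed.

Lemma padic_abs_frac a b : a != 0 -> b != 0 ->
  v[a%:~R / b%:~R] = p%:R ^+ logn p `|b|%N / p%:R ^+ logn p `|a|%N.
Proof.
move=> a0 b0; set x : rat := a%:~R / b%:~R.
have b0' : b%:~R != 0 :> rat by rewrite intr_eq0.
have x0 : x != 0 by rewrite mulf_neq0 ?invr_eq0// intr_eq0.
rewrite /padic_abs (negPf x0).
have E : (a * denq x = numq x * b)%R.
  apply: (@intr_inj rat); rewrite !rmorphM/= numqE mulrAC; congr (_ * _).
  by rewrite /x divfK.
have /(congr1 (logn p)) : (`|a| * `|denq x| = `|numq x| * `|b|)%N.
  by rewrite -!abszM E.
rewrite !lognM ?absz_gt0 ?denq_eq0 ?numq_eq0// => L.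
by apply/eqP; rewrite eqr_div// -!exprD addnC L addnC.
Qed.

Lemma padic_absM x y : v[x * y] = v[x] * v[y].
Proof.
have [->|x0] := eqVneq x 0; first by rewrite mul0r padic_abs0 mul0r.
have [->|y0] := eqVneq y 0; first by rewrite mulr0 padic_abs0 mulr0.
rewrite -{1}(divq_num_den x) -{1}(divq_num_den y) mulf_div -!rmorphM/=.
rewrite padic_abs_frac ?mulf_neq0 ?numq_eq0 ?denq_eq0//.
rewrite !abszM !lognM ?absz_gt0 ?denq_eq0 ?numq_eq0// !exprD.
by rewrite /padic_abs (negPf x0) (negPf y0) mulf_div.
Qed.

Lemma padic_abs1 : v[1] = 1.
Proof.
rewrite -[1]divr1 (_ : 1 = 1%:~R)// padic_abs_frac//.
by rewrite /= logn1 expr0 divr1.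
Qed.

Lemma padic_absV x : v[x^-1] = v[x]^-1.
Proof.
have [->|x0] := eqVneq x 0; first by rewrite [in LHS]invr0 padic_abs0 [RHS]invr0.
apply: (mulfI (_ : v[x] != 0)); first by rewrite padic_abs_eq0.
by rewrite -padic_absM !divff ?padic_abs_eq0// padic_abs1.
Qed.

Lemma padic_absN x : v[- x] = v[x].
Proof.
rewrite -mulN1r padic_absM -[RHS]mul1r; congr (_ * _).
rewrite -[- 1]divr1 (_ : -1 = (-1)%:~R)// (_ : 1 = 1%:~R)//.
by rewrite padic_abs_frac//= logn1 expr0 divr1.
Qed.

Lemma padic_abs_int a : v[a%:~R] <= 1.
Proof.
have [->|a0] := eqVneq a 0; first by rewrite padic_abs0.
rewrite -[a%:~R]divr1 (_ : 1 = 1%:~R)// padic_abs_frac//= logn1 expr0 mul1r.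
rewrite invf_le1 ?exprn_gt0 ?ltr0n ?prime_gt0//.
by rewrite exprn_ege1// ler1n prime_gt0.
Qed.

Lemma padic_abs_den x : (v[x] <= 1) = ~~ (p %| `|denq x|)%N.
Proof.
apply/idP/idP => [|px].
  apply: contraL => px; rewrite -ltNge.
  have x0 : x != 0.
    by apply: contraTneq px => ->; rewrite (denq_int 0) dvdn1 (gtn_eqF (prime_gt1 p_pr)).
  have nx : ~~ (p %| `|numq x|)%N.
    apply/negP => pn; have := dvdn_gcd p `|numq x| `|denq x|.
    rewrite pn px (eqP (coprime_num_den x)) dvdn1.
    by rewrite (gtn_eqF (prime_gt1 p_pr)).
  rewrite /padic_abs (negPf x0) (lognE _ `|numq x|) (negPf nx) !andbF expr0 divr1.
  rewrite exprn_egt1 ?ltr1n ?prime_gt1//.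
  by rewrite -lt0n logn_gt0 mem_primes p_pr absz_gt0 denq_eq0.
have [->|x0] := eqVneq x 0; first by rewrite padic_abs0.
rewrite /padic_abs (negPf x0) (lognE _ `|denq x|) (negPf px) !andbF expr0.
rewrite mul1r invf_le1 ?exprn_gt0 ?ltr0n ?prime_gt0//.
by rewrite exprn_ege1// ler1n prime_gt0.
Qed.

Lemma padic_abs_ultra x y : v[x + y] <= Num.max v[x] v[y].
Proof.
have D1 z : v[z] <= 1 -> v[1 + z] <= 1.
  move=> z1; have [/eqP -> |nz0] := boolP (1 + z == 0); first by rewrite padic_abs0.
  have -> : 1 + z = (denq z + numq z)%:~R / (denq z)%:~R.
    rewrite -{1}(divq_num_den z) rmorphD/= mulrDl divff//.
    by rewrite intr_eq0 denq_eq0.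
  rewrite padic_absM.
  move: z1; rewrite padic_abs_den => pz.
  rewrite padic_absV (_ : v[(denq z)%:~R] = 1) ?invr1 ?mulr1 ?padic_abs_int//.
  rewrite -[_%:~R]divr1 (_ : 1 = 1%:~R)// padic_abs_frac ?denq_eq0//= logn1.
  by rewrite lognE (negPf pz) !andbF !expr0 divr1.
wlog xy : x y / v[x] <= v[y].
  by move=> H; case/orP: (le_total v[x] v[y]) => /H//; rewrite addrC maxC.
rewrite (max_idPr xy); have [y0|y0] := eqVneq y 0.
  move: xy; rewrite y0 padic_abs0 addr0 => x0; exact: x0.
have -> : x + y = y * (1 + x / y) by rewrite mulrDr mulr1 addrC mulrC divfK.
rewrite padic_absM ler_piMr ?padic_abs_ge0// D1// padic_absM padic_absV.
by rewrite ler_pdivrMr ?mul1r// padic_abs_gt0.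
Qed.

Lemma padic_abs_eq x y : v[x - y] < v[y] -> v[x] = v[y].
Proof.
move=> xy; apply/eqP; rewrite eq_le; apply/andP; split.
  by rewrite -{1}(subrK y x) (le_trans (padic_abs_ultra _ _))// ge_max lexx ltW.
rewrite leNgt; apply/negP => yx.
have := padic_abs_ultra x (- (x - y)); rewrite subKr padic_absN.
by rewrite leNgt gt_max yx xy.
Qed.

End PadicAbs.

Section CauchyRing.
Variables (p : nat) (p_pr : prime p).
Local Notation v := (padic_abs p).
Implicit Types (u w : nat -> rat).

Definition padic_cauchy u := forall e : rat, 0 < e ->
  exists N, forall i j, (N <= i)%N -> (N <= j)%N -> v (u i - u j) < e.

Definition padic_null u := forall e : rat, 0 < e ->
  exists N, forall i, (N <= i)%N -> v (u i) < e.

Lemma padic_cauchy_bounded u : padic_cauchy u ->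
  exists2 M : rat, 0 < M & exists N, forall i, (N <= i)%N -> v (u i) <= M.
Proof.
move=> /(_ 1 ltr01)[N uN]; exists (Num.max 1 (v (u N))).
  by rewrite lt_max ltr01.
exists N => i Ni; rewrite -[u i](subrK (u N)).
apply: le_trans (padic_abs_ultra p_pr _ _) _.
by rewrite ge_max !le_max (ltW (uN _ _ Ni _))// lexx orbT.
Qed.

Lemma padic_cauchyB u w : padic_cauchy u -> padic_cauchy w ->
  padic_cauchy (u - w).
Proof.
move=> cu cw e e0; have [N uN] := cu _ e0; have [M wM] := cw _ e0.
exists (maxn N M) => i j; rewrite !geq_max => /andP[Ni Mi] /andP[Nj Mj].
rewrite [X in v X](_ : _ = (u i - u j) + (w j - w i)).
  apply: le_lt_trans (padic_abs_ultra p_pr _ _) _.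
  by rewrite gt_max uN// wM.
by rewrite /= !fctE; lra.
Qed.

Lemma padic_cauchyM u w : padic_cauchy u -> padic_cauchy w ->
  padic_cauchy (u * w).
Proof.
move=> cu cw e e0.
have [A A0 [N1 uA]] := padic_cauchy_bounded cu.
have [B B0 [N2 wB]] := padic_cauchy_bounded cw.
have [N3 uN] := cu _ (divr_gt0 e0 B0); have [N4 wN] := cw _ (divr_gt0 e0 A0).
exists (maxn (maxn N1 N2) (maxn N3 N4)) => i j.
rewrite !geq_max => /andP[/andP[i1 i2] /andP[i3 i4]] /andP[/andP[j1 j2] /andP[j3 j4]].
rewrite [X in v X](_ : _ = (u i - u j) * w i + u j * (w i - w j)); last first.
  by rewrite !fctE; ring.
apply: le_lt_trans (padic_abs_ultra p_pr _ _) _.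
rewrite !(padic_absM p_pr) gt_max; apply/andP; split.
  apply: le_lt_trans (ler_wpM2l (padic_abs_ge0 p_pr _) (wB _ i2)) _.
  by rewrite -ltr_pdivlMr// uN.
apply: le_lt_trans (ler_wpM2r (padic_abs_ge0 p_pr _) (uA _ j1)) _.
by rewrite mulrC -ltr_pdivlMr// wN.
Qed.

Lemma padic_cauchy_cst (r : rat) : padic_cauchy (cst r).
Proof. by move=> e e0; exists 0%N => i j _ _; rewrite /= subrr padic_abs0. Qed.

(* Away from 0 the absolute value of a Cauchy sequence is eventually constant. *)
Lemma padic_cauchy_abs u : padic_cauchy u -> ~ padic_null u ->
  exists N, forall i, (N <= i)%N -> v (u i) = v (u N) /\ u i != 0.
Proof.
move=> cu /existsNP[e /not_implyP[e0 /forallNP nu]].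
have [N uN] := cu _ e0.
have [i /not_implyP[Ni /negP]] : exists i, ~ ((N <= i)%N -> v (u i) < e).
  exact/existsNP/nu.
rewrite -leNgt => ei.
have E j : (N <= j)%N -> v (u j) = v (u i).
  by move=> Nj; apply: (padic_abs_eq p_pr); apply: lt_le_trans ei; exact: uN.
exists N => j Nj; rewrite E// (E N)//; split=> //.
by rewrite -(padic_abs_eq0 p_pr) E// gt_eqF// (lt_le_trans e0 ei).
Qed.

Definition padic_cauchy_pred of prime p : {pred nat -> rat} :=
  fun u => `[< padic_cauchy u >].

Lemma padic_cauchy_subring : subring_closed (padic_cauchy_pred p_pr).
Proof.
split=> [|u w /asboolP cu /asboolP cw|u w /asboolP cu /asboolP cw];
  apply/asboolP.
- exact: padic_cauchy_cst.
- exact: padic_cauchyB.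
- exact: padic_cauchyM.
Qed.

HB.instance Definition _ := GRing.isSubringClosed.Build (nat -> rat)
  (padic_cauchy_pred p_pr) padic_cauchy_subring.

Record cauchy_seq := CauchySeq {
  cauchy_val :> nat -> rat;
  cauchy_valP : cauchy_val \in padic_cauchy_pred p_pr }.

HB.instance Definition _ := [isSub for cauchy_val].
HB.instance Definition _ := [Choice of cauchy_seq by <:].
HB.instance Definition _ := [SubChoice_isSubComNzRing of cauchy_seq by <:].

Lemma cauchy_seqP (u : cauchy_seq) : padic_cauchy u.
Proof. exact/asboolP/cauchy_valP. Qed.

Definition null_seq : {pred cauchy_seq} :=
  fun u : cauchy_seq => `[< padic_null u >].

Lemma null_seq_idealr : idealr_closed null_seq.
Proof.
split.
- by apply/asboolP => e e0; exists 0%N => i _; rewrite /= padic_abs0.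
- apply/asboolPn => /(_ 1 ltr01)[N /(_ N (leqnn N))].
  by rewrite /= padic_abs1// ltxx.
- move=> a u w /asboolP u0 /asboolP w0; apply/asboolP => e e0.
  have [A A0 [N1 aA]] := padic_cauchy_bounded (cauchy_seqP a).
  have [N2 uN] := u0 _ (divr_gt0 e0 A0); have [N3 wN] := w0 _ e0.
  exists (maxn N1 (maxn N2 N3)) => i; rewrite !geq_max => /and3P[i1 i2 i3].
  rewrite [cauchy_val _]/= !fctE.
  apply: le_lt_trans (padic_abs_ultra p_pr _ _) _.
  rewrite gt_max wN// andbT padic_absM//.
  apply: le_lt_trans (ler_wpM2r (padic_abs_ge0 p_pr _) (aA _ i1)) _.
  by rewrite mulrC -ltr_pdivlMr// uN.
Qed.

HB.instance Definition _ := isIdealr.Build cauchy_seq null_seq null_seq_idealr.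

(* The completion of rat for padic_abs: Cauchy sequences modulo null ones. *)
Definition Qp : Type := {ideal_quot null_seq}.

HB.instance Definition _ := GRing.ComNzRing.on Qp.
HB.instance Definition _ := EqQuotient.on Qp.

End CauchyRing.

Section Qp.
Variables (p : nat) (p_pr : prime p).
Local Notation v := (padic_abs p).
Local Notation Qp := (Qp p_pr).
Local Notation cauchy_seq := (cauchy_seq p_pr).
Implicit Types (x y : Qp) (u w : cauchy_seq) (r : rat).

Lemma Qp_pi0 : \pi_Qp 0 = 0 :> Qp. Proof. by rewrite piE. Qed.

Lemma Qp_pi1 : \pi_Qp 1 = 1 :> Qp. Proof. by rewrite piE. Qed.

Lemma Qp_piD u w : \pi_Qp (u + w) = \pi_Qp u + \pi_Qp w :> Qp.
Proof. by rewrite piE. Qed.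

Lemma Qp_piN u : \pi_Qp (- u) = - \pi_Qp u :> Qp. Proof. by rewrite piE. Qed.

Lemma Qp_piM u w : \pi_Qp (u * w) = \pi_Qp u * \pi_Qp w :> Qp.
Proof. by rewrite piE. Qed.

Lemma Qp_eq0 u : (\pi_Qp u == 0 :> Qp) <-> padic_null p u.
Proof.
rewrite -Qp_pi0 -Quotient.idealrBE subr0.
by split=> /asboolP.
Qed.

Lemma Qp_mulVx x : x != 0 -> exists y, y * x = 1.
Proof.
rewrite -[x]reprK; set u := repr x => /negP.
move/Qp_eq0 => nu; have cu := cauchy_seqP u.
have [N uN] := padic_cauchy_abs p_pr cu nu.
have uN0 := (uN _ (leqnn N)).2.
have vN : 0 < v (u N) by exact: padic_abs_gt0.
have cV : (fun i => (u i)^-1) \in padic_cauchy_pred p_pr.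
  apply/asboolP => e e0.
  have [M uM] := cu _ (mulr_gt0 e0 (mulr_gt0 vN vN)).
  exists (maxn N M) => i j; rewrite !geq_max => /andP[Ni Mi] /andP[Nj Mj].
  have [vi ui] := uN _ Ni; have [vj uj] := uN _ Nj.
  rewrite [X in v X](_ : _ = (u j - u i) * ((u i)^-1 * (u j)^-1)).
    rewrite !(padic_absM p_pr) !(padic_absV p_pr) vi vj -invfM.
    by rewrite ltr_pdivrMr ?mulr_gt0// uM.
  by rewrite /=; field; rewrite ui uj.
exists (\pi_Qp (CauchySeq cV)).
rewrite -Qp_pi1 -Qp_piM; apply/eqP; rewrite -Quotient.idealrBE.
apply/asboolP => e e0; exists N => i Ni.
rewrite (_ : cauchy_val _ i = (u i)^-1 * u i - 1)//.
by rewrite mulVf ?(uN _ Ni).2// subrr padic_abs0.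
Qed.

Definition Qp_inv x : Qp := xget 0 [set y | y * x = 1].

Lemma Qp_mulVf x : x != 0 -> Qp_inv x * x = 1.
Proof. by move=> /Qp_mulVx; exact: (@xgetPex _ 0 [set y | y * x = 1]). Qed.

Lemma Qp_inv0 : Qp_inv 0 = 0.
Proof.
by rewrite /Qp_inv; case: xgetP => // y _ /esym/eqP; rewrite mulr0 oner_eq0.
Qed.

HB.instance Definition _ := GRing.ComNzRing_isField.Build Qp Qp_mulVf Qp_inv0.

(* The p-adic absolute value of a Cauchy sequence that does not tend to 0 is
   eventually constant; for a null sequence the value is 0. *)
Definition Qp_norm x : rat :=
  xget 0 [set r | exists N, forall i, (N <= i)%N -> v (repr x i) = r].

Lemma cst_cauchy r : cst r \in padic_cauchy_pred p_pr.
Proof. exact/asboolP/padic_cauchy_cst. Qed.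

Definition Qp_of_rat r : Qp := \pi_Qp (CauchySeq (cst_cauchy r)).

Lemma Qp_norm0 : Qp_norm 0 = 0.
Proof.
rewrite /Qp_norm; case: xgetP => // r _ [N rN].
have /Qp_eq0 z : \pi_Qp (repr (0 : Qp)) == 0 :> Qp by rewrite reprK.
apply/eqP/negPn/negP => r0.
have {}r0 : 0 < r by rewrite lt_def r0 -(rN _ (leqnn N)) padic_abs_ge0.
have [M zM] := z _ r0.
by have := zM _ (leq_maxr N M); rewrite rN ?leq_maxl// ltxx.
Qed.

Lemma Qp_normE x : x != 0 -> 0 < Qp_norm x /\
  exists N, forall i, (N <= i)%N -> v (repr x i) = Qp_norm x.
Proof.
rewrite -{1}[x]reprK => /negP/Qp_eq0 nx.
have [N xN] := padic_cauchy_abs p_pr (cauchy_seqP _) nx.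
have ex : exists r, exists N, forall i, (N <= i)%N -> v (repr x i) = r.
  by exists (v (repr x N)), N => i Ni; exact: (xN _ Ni).1.
have [M xM] := @xgetPex _ 0 [set r | _] ex; rewrite -/(Qp_norm x) in xM.
split; last by exists M.
rewrite -(xM _ (leq_maxr N M)) padic_abs_gt0//.
exact: (xN _ (leq_maxl N M)).2.
Qed.

Lemma Qp_norm_ge0 x : 0 <= Qp_norm x.
Proof. by have [->|/Qp_normE[/ltW]//] := eqVneq x 0; rewrite Qp_norm0. Qed.

Lemma Qp_norm_eq0 x : (Qp_norm x == 0) = (x == 0).
Proof.
have [->|/Qp_normE[x0 _]] := eqVneq x 0; first by rewrite Qp_norm0 eqxx.
by rewrite gt_eqF.
Qed.

(* The absolute value can be computed on any representative. *)
Lemma Qp_norm_pi u r : r != 0 ->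
  (exists N, forall i, (N <= i)%N -> v (u i) = r) -> Qp_norm (\pi_Qp u) = r.
Proof.
move=> r0 [N uN].
have {}r0 : 0 < r by rewrite lt_def r0 -(uN _ (leqnn N)) padic_abs_ge0.
have /Qp_normE[_ [M xM]] : \pi_Qp u != 0 :> Qp.
  apply/negP => /Qp_eq0 /(_ _ r0)[M uM].
  by have := uM _ (leq_maxr N M); rewrite uN ?leq_maxl// ltxx.
have /eqP : \pi_Qp (repr (\pi_Qp u : Qp)) = \pi_Qp u :> Qp by rewrite reprK.
rewrite -Quotient.idealrBE => /asboolP /(_ _ r0)[K uK].
pose i := maxn (maxn N M) K.
have [Ni Mi Ki] : [/\ (N <= i)%N, (M <= i)%N & (K <= i)%N].
  by rewrite /i !leq_max !leqnn ?orbT.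
rewrite -(xM i Mi) -(uN i Ni); apply: (padic_abs_eq p_pr).
rewrite uN//; exact: uK.
Qed.

Lemma Qp_norm_rat r : Qp_norm (Qp_of_rat r) = v r.
Proof.
have [->|r0] := eqVneq r 0.
  rewrite padic_abs0; apply/eqP; rewrite Qp_norm_eq0.
  by apply/Qp_eq0 => e e0; exists 0%N => i _; rewrite /= padic_abs0.
apply: Qp_norm_pi; first by rewrite padic_abs_eq0.
by exists 0%N.
Qed.

Lemma Qp_normN x : Qp_norm (- x) = Qp_norm x.
Proof.
have [->|x0] := eqVneq x 0; first by rewrite oppr0.
have [n0 [N xN]] := Qp_normE x0.
rewrite -{1}[x]reprK -Qp_piN; apply: Qp_norm_pi.
  by rewrite gt_eqF.
by exists N => i /xN <-; rewrite -[RHS](padic_absN p_pr).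
Qed.

Lemma Qp_norm_ultra x y :
  Qp_norm (x + y) <= Num.max (Qp_norm x) (Qp_norm y).
Proof.
have [->|x0] := eqVneq x 0; first by rewrite add0r le_max lexx orbT.
have [->|y0] := eqVneq y 0; first by rewrite addr0 le_max lexx.
have [s0|s0] := eqVneq (x + y) 0; first by rewrite s0 Qp_norm0 le_max Qp_norm_ge0.
have [nx [N xN]] := Qp_normE x0; have [ny [M yM]] := Qp_normE y0.
have E : x + y = \pi_Qp (repr x + repr y).
  by rewrite -{1}[x]reprK -{1}[y]reprK -Qp_piD.
have /negP ns := s0; rewrite E in ns.
have {ns} nz : ~ padic_null p (repr x + repr y) by move=> /Qp_eq0.
have [K sK] := padic_cauchy_abs p_pr (cauchy_seqP _) nz.
have -> : Qp_norm (x + y) = v ((repr x + repr y : cauchy_seq) K).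
  rewrite E; apply: Qp_norm_pi.
    by rewrite padic_abs_eq0//; exact: (sK _ (leqnn K)).2.
  by exists K => i /sK[].
pose i := maxn (maxn N M) K.
have [Ni Mi Ki] : [/\ (N <= i)%N, (M <= i)%N & (K <= i)%N].
  by rewrite /i !leq_max !leqnn ?orbT.
by rewrite -(sK i Ki).1 -(xN i Ni) -(yM i Mi); exact: padic_abs_ultra.
Qed.

Definition Qp_dist x y : rat := Qp_norm (x - y).

Lemma Qp_distxx x : Qp_dist x x = 0.
Proof. by rewrite /Qp_dist subrr Qp_norm0. Qed.

Lemma Qp_dist_eq0 x y : Qp_dist x y = 0 -> x = y.
Proof. by move/eqP; rewrite Qp_norm_eq0 subr_eq0 => /eqP. Qed.

Lemma Qp_dist_sym x y : Qp_dist x y = Qp_dist y x.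
Proof. by rewrite /Qp_dist -opprB Qp_normN. Qed.

Lemma Qp_dist_triangle y x z : Qp_dist x z <= Qp_dist x y + Qp_dist y z.
Proof.
rewrite /Qp_dist -[x in leLHS](subrK y) -addrA.
apply: le_trans (Qp_norm_ultra _ _) _.
by rewrite ge_max lerDl lerDr !Qp_norm_ge0.
Qed.

HB.instance Definition _ := isMetric.Build rat Qp
  Qp_distxx Qp_dist_eq0 Qp_dist_sym Qp_dist_triangle.

HB.instance Definition _ := isPointed.Build Qp 0.

End Qp.

Section FractionalPart.
Variables (p : nat) (p_pr : prime p).
Local Notation v := (padic_abs p).
Local Notation Qp := (Qp p_pr).
Implicit Types (x : Qp) (r s : rat).

(* With x = \sum_(j >= - m) x_j p^j (0 <= x_j < p), the fractional part is
   \sum_(- m <= j < 0) x_j p^j, that is the unique rational r = a / p^k in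
   [0, 1[ such that x - r is a p-adic integer. *)
Definition is_fracp x r :=
  [/\ 0 <= r < 1, exists k, p%:R ^+ k * r \in Num.int
    & Qp_norm (x - Qp_of_rat p_pr r) <= 1].

Definition fracp x : rat := xget 0 (is_fracp x).

Let pX0 k : p%:R ^+ k != 0 :> rat.
Proof. by rewrite expf_neq0// pnatr_eq0 -lt0n prime_gt0. Qed.

Lemma Qp_of_ratB r s : Qp_of_rat p_pr (r - s) = Qp_of_rat p_pr r - Qp_of_rat p_pr s.
Proof.
rewrite /Qp_of_rat -Qp_piN -Qp_piD; congr (\pi _).
by apply: val_inj; apply/funext.
Qed.

Lemma Qp_rat_dense x : exists r, Qp_norm (x - Qp_of_rat p_pr r) <= 1.
Proof.
have [N xN] := cauchy_seqP (repr x) ltr01; pose r := repr x N; exists r.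
have [->|d0] := eqVneq (x - Qp_of_rat p_pr r) 0; first by rewrite Qp_norm0.
have E : x - Qp_of_rat p_pr r = \pi_Qp (repr x - CauchySeq (cst_cauchy p_pr r)).
  by rewrite Qp_piD Qp_piN reprK.
have /negP := d0; rewrite E => nz.
have {}nz : ~ padic_null p (repr x - CauchySeq (cst_cauchy p_pr r)).
  by move=> /Qp_eq0.
have [K sK] := padic_cauchy_abs p_pr (cauchy_seqP _) nz.
rewrite (@Qp_norm_pi _ _ _ (v ((repr x - CauchySeq (cst_cauchy p_pr r)) K))).
- rewrite -(sK _ (leq_maxr N K)).1; apply/ltW.
  by rewrite -[X in v X]/(repr x (maxn N K) - r) xN// leq_maxl.
- by rewrite padic_abs_eq0//; exact: (sK _ (leqnn K)).2.
- by exists K => i /sK[].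
Qed.

Lemma fracpP x : is_fracp x (fracp x).
Proof.
apply: xgetPex; have [q xq] := Qp_rat_dense x.
have [|b pb dE] := @pfactor_coprime p `|denq q| p_pr.
  by rewrite absz_gt0 denq_eq0.
set k := logn _ _ in dE.
have b0 : (b%:Z != 0)%R.
  by apply: contra_eqN dE => /eqP[->]; rewrite mul0n absz_eq0 denq_eq0.
have /coprimezP[[e f] /= ef] : coprimez (p ^ k)%N b.
  by rewrite coprimezE /= coprimeXl.
have pk0 : 0 < ((p ^ k)%N : int) by rewrite ltz_nat expn_gt0 prime_gt0.
have pkE : ((p ^ k)%N : int)%:~R = p%:R ^+ k :> rat by rewrite -pmulrn natrX.
pose c := (numq q * f %% (p ^ k)%N)%Z.
exists (c%:~R / p%:R ^+ k); split.
- rewrite divr_ge0 ?exprn_ge0 ?ler0n// ?ler0z ?modz_ge0 ?gt_eqF//=.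
  rewrite ltr_pdivrMr ?exprn_gt0 ?ltr0n ?prime_gt0// mul1r -pkE ltr_int.
  exact: ltz_pmod.
- by exists k; rewrite mulrC divfK// intr_int.
- pose r : rat := c%:~R / p%:R ^+ k.
  rewrite -/r -(subrKA (Qp_of_rat p_pr q)) -Qp_of_ratB.
  apply: le_trans (Qp_norm_ultra _ _) _; rewrite ge_max xq/= Qp_norm_rat.
  have b0' : b%:~R != 0 :> rat by rewrite intr_eq0.
  pose t : int := numq q * e + (numq q * f %/ (p ^ k)%N)%Z * b.
  have -> : q - r = t%:~R / b%:~R.
    have qE : q = (numq q)%:~R / (b%:~R * p%:R ^+ k).
      rewrite -[LHS]divq_num_den; congr (_ / _).
      by rewrite -absz_denq dE PoszM rmorphM/= pkE.
    have cE : c%:~R = (numq q)%:~R * f%:~R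
        - (numq q * f %/ (p ^ k)%N)%Z%:~R * p%:R ^+ k :> rat.
      by rewrite -pkE -!rmorphM -rmorphB.
    have ef1 : e%:~R * p%:R ^+ k + f%:~R * b%:~R = 1 :> rat.
      by rewrite -pkE -!rmorphM -rmorphD/= ef.
    rewrite /r cE {1}qE /t rmorphD !rmorphM/=.
    set n := (numq q)%:~R.
    rewrite -[n / _]mulr1 -[X in _ * X - _]ef1.
    by field; rewrite pX0 b0'.
  rewrite padic_absM// padic_absV// -[X in _ / X](_ : 1 = _).
    by rewrite divr1 padic_abs_int.
  apply/esym; rewrite -[b%:~R]divr1 (_ : 1 = 1%:~R)// padic_abs_frac//= logn1.
  move: pb; rewrite prime_coprime// => pb.
  by rewrite lognE (negPf pb) !andbF expr0 divr1.
Qed.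

Lemma fracp_unique x r s : is_fracp x r -> is_fracp x s -> r = s.
Proof.
move=> [/andP[r0 r1] [k /intrP[a ka]] xr] [/andP[s0 s1] [l /intrP[b lb]] xs].
have : v (r - s) <= 1.
  rewrite -(Qp_norm_rat p_pr) Qp_of_ratB.
  rewrite -[X in Qp_norm X](subrKA x) -[X in X + _]opprB.
  apply: le_trans (Qp_norm_ultra _ _) _.
  by rewrite Qp_normN ge_max xr xs.
rewrite padic_abs_den//; set z := r - s => pd.
have /intrP[m zm] : (p%:R ^+ (k + l) * z) \in Num.int.
  have -> : p%:R ^+ (k + l) * z = a%:~R * (p ^ l)%:R - (p ^ k)%:R * b%:~R.
    by rewrite -ka -lb !natrX exprD /z; ring.
  by rewrite rpredB ?rpredM ?intr_int ?natr_int.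
have E : (numq z * (p ^ (k + l))%N = m * denq z)%R.
  by apply: (@intr_inj rat); rewrite !rmorphM/= numqE -zm -pmulrn natrX; ring.
have d1 : denq z = 1.
  rewrite -absz_denq; congr Posz; apply/eqP; rewrite -dvdn1.
  rewrite -(@Gauss_dvdr _ (p ^ (k + l))) ?muln1; last first.
    by rewrite coprimeXr// coprime_sym prime_coprime.
  rewrite -(@Gauss_dvdr _ `|numq z|); last by rewrite coprime_sym coprime_num_den.
  have /(congr1 absz) := E; rewrite !abszM => ->.
  exact: dvdn_mull.
have zE : z = (numq z)%:~R by rewrite numqE d1 mulr1.
have : `|z| < 1.
  by rewrite /z ltr_norml; apply/andP; split; lra.
rewrite zE -intr_norm (_ : 1 = 1%:~R)// ltr_int -[1]add0r ltzD1 normr_le0.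
by move=> /eqP n0; apply/eqP; rewrite -subr_eq0 -/z zE n0.
Qed.

End FractionalPart.

Local Close Scope quotient_scope.
Local Open Scope complex_scope.

(* 'rV[Qp p_pr]_n, with its product topology, as a Borel measurable space. *)
Notation borelQp p_pr n := (g_sigma_algebraType (@open 'rV[Qp p_pr]_n)).

Section Analysis.
Context (R : realType) (p : nat) (p_pr : prime p) (n : nat).
Local Notation Qpn := 'rV[Qp p_pr]_n.
Local Notation B := (borelQp p_pr n).
Local Notation C := R[i].

Definition unit_ball : set Qpn := [set x | forall j, Qp_norm (x 0 j) <= 1].

(* Haar measure on Q_p^n is the unique such measure; a translation-invariant
   Borel measure that is finite on the unit ball is automatically Radon. *)
Definition normalized_haar (mu : {measure set B -> \bar R}) : Prop :=
  mu unit_ball = 1%E /\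
  forall (a : Qpn) (A : set B), measurable A ->
    mu [set a + x | x in (A : set Qpn)] = mu A.

Definition cmeasurable (f : Qpn -> C) : Prop :=
  measurable_fun [set: B] (fun x : B => complex.Re (f x)) /\
  measurable_fun [set: B] (fun x : B => complex.Im (f x)).

Definition cintegral (mu : {measure set B -> \bar R}) (f : Qpn -> C) : C :=
  (\int[mu]_x complex.Re (f x)) +i* (\int[mu]_x complex.Im (f x)).

Definition cnorm (mu : {measure set B -> \bar R}) (rho : R) (f : Qpn -> C) :
    \bar R :=
  Lnorm mu rho%:E (fun x : B => (complex.Re `|f x|)%:E).

(* Functions rather than classes modulo a.e. equality: cnorm is a seminorm, and
   density is density for it. *)
Definition cLspace (mu : {measure set B -> \bar R}) (rho : R) :
    set (Qpn -> C) :=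
  [set f | cmeasurable f /\ (cnorm mu rho f < +oo)%E].

Definition dense_in_cLspace (mu : {measure set B -> \bar R}) (rho : R)
    (D : set (Qpn -> C)) : Prop :=
  D `<=` cLspace mu rho /\
  forall f, cLspace mu rho f -> forall e : R, 0 < e ->
    exists2 g, D g & (cnorm mu rho (f \- g)%R < e%:E)%E.

Definition locally_constant (f : Qpn -> C) : Prop :=
  forall x, \forall y \near x, f y = f x.

Definition test_functions : set (Qpn -> C) :=
  [set f | locally_constant f /\ compact (closure [set x | f x != 0])].

Definition chi (xi x : Qpn) : C :=
  let t : R := 2 * pi * ratr (\sum_j fracp (xi 0 j * x 0 j)) in
  cos t +i* sin t.

Definition fourier (mu : {measure set B -> \bar R}) (f : Qpn -> C) : Qpn -> C :=
  fun xi => cintegral mu (fun x => chi xi x * f x).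

Definition Psi : set (Qpn -> C) :=
  [set psi | test_functions psi /\ psi 0 = 0].

Definition Phi (mu : {measure set B -> \bar R}) : set (Qpn -> C) :=
  fourier mu @` Psi.

End Analysis.

(* Main.v *)
(* Locally constant functions with compact support are those supported in a ball
   of radius p^k and invariant under the ball of radius p^-k, for some k
   ([tame k]); the Fourier transform preserves this class and, since it maps the
   indicator of the ball B_s of radius p^s to p^(ns) times that of B_-s, is onto
   it. If f = F[g] with g tame, subtracting g(0) 1_(B_-m) from g gives an element
   of Psi and changes f by g(0) p^(-nm) 1_(B_m), whose L^rho norm tends to 0 with
   m because rho > 1 and n >= 1. So tame functions are limits of elements of Phi,
   and it remains to reach all of L^rho: by the pi-lambda theorem for indicators
   (an open set is the increasing union of its largest B_-i-invariant subsets),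
   then by simple functions and dominated convergence. *)

Require Import Defs.
From mathcomp Require Import all_boot all_order all_algebra generic_quotient.
From mathcomp Require Import finmap archimedean ring lra complex.
From mathcomp Require Import all_classical all_reals all_analysis.
From mathcomp Require Import measurable_realfun.

Set Implicit Arguments.
Unset Strict Implicit.
Unset Printing Implicit Defensive.

Import Order.TTheory GRing.Theory Num.Theory numFieldNormedType.Exports.

Local Open Scope classical_set_scope.
Local Open Scope ring_scope.

(** * Arithmetic of the p-adic field *)

Section QpArithmetic.
Variables (p : nat) (p_pr : prime p).
Local Notation v := (padic_abs p).
Local Notation Qp := (Qp p_pr).
Local Notation ofQ := (Qp_of_rat p_pr).
Implicit Types (x y : Qp) (r t : rat) (z s : int).

Lemma natp_gt0 : 0 < p%:R :> rat.
Proof. by rewrite ltr0n prime_gt0. Qed.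

Lemma natp_neq0 : p%:R != 0 :> rat.
Proof. by rewrite gt_eqF// natp_gt0. Qed.

Lemma pz_gt0 z : 0 < p%:R ^ z :> rat.
Proof. exact: exprz_gt0 natp_gt0. Qed.

Lemma pz_ge0 z : 0 <= p%:R ^ z :> rat.
Proof. exact/ltW/pz_gt0. Qed.

Lemma ler_pz z s : (z <= s)%R -> p%:R ^ z <= p%:R ^ s :> rat.
Proof. by move=> zs; rewrite ler_weXz2l// ler1n prime_gt0. Qed.

Lemma pz_small (e : rat) : 0 < e -> exists k : nat, p%:R ^ (- k%:Z) < e :> rat.
Proof.
move=> e0; exists (Num.bound e^-1).
have := archi_boundP (ltW (etrans (invr_gt0 e) e0)).
set k := Num.bound _ => ek.
rewrite -invr_expz -exprnP -[ltRHS]invrK ltf_pV2 ?posrE ?invr_gt0// ?exprn_gt0 ?natp_gt0//.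
by apply: lt_le_trans ek _; rewrite -natrX ler_nat ltnW// ltn_expl// prime_gt1.
Qed.

Lemma pz_large (e : rat) : exists k : nat, e <= p%:R ^ k%:Z :> rat.
Proof.
have e0 : 0 < Num.max 1 e by rewrite lt_max ltr01.
have [|k] := @pz_small (Num.max 1 e)^-1; first by rewrite invr_gt0.
rewrite -invr_expz ltf_pV2 ?posrE ?pz_gt0// => /ltW H; exists k.
by apply: le_trans H; rewrite le_max lexx orbT.
Qed.

Lemma padic_absX z : v (p%:R ^ z) = p%:R ^ (- z).
Proof.
have vp : v p%:R = p%:R^-1.
  rewrite -[X in v X]divr1 (_ : 1 = 1%:~R)// (_ : p%:R = p%:Z%:~R)//.
  rewrite padic_abs_frac//; last by rewrite -(intr_eq0 rat) natp_neq0.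
  by rewrite /= logn1 expr0 logn_prime// eqxx expr1 div1r.
have vX k : v (p%:R ^+ k) = p%:R ^- k.
  elim: k => [|k IH]; first by rewrite expr0 padic_abs1// invr1.
  by rewrite exprS padic_absM// IH vp invfM.
case: z => k; first by rewrite -exprnP vX -exprnN.
by rewrite NegzE opprK -invr_expz -!exprnP padic_absV// vX invrK.
Qed.

(** The denominator of [t] divides a power of [p] by the first hypothesis and is prime to [p] by the
    second, so it is 1. *)
Lemma padic_int_int t : (exists k, p%:R ^+ k * t \in Num.int) -> v t <= 1 ->
  t \in Num.int.
Proof.
move=> [k /intrP[m tm]]; rewrite padic_abs_den// => pd.
have E : (numq t * (p ^ k)%N = m * denq t)%R.
  by apply: (@intr_inj rat); rewrite !rmorphM/= numqE -tm -pmulrn natrX; ring.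
rewrite Qint_def -absz_denq; apply/eqP; congr Posz; apply/eqP; rewrite -dvdn1.
rewrite -(@Gauss_dvdr _ (p ^ k)) ?muln1; last first.
  by rewrite coprimeXr// coprime_sym prime_coprime.
rewrite -(@Gauss_dvdr _ `|numq t|); last by rewrite coprime_sym coprime_num_den.
have /(congr1 absz) := E; rewrite !abszM => ->.
exact: dvdn_mull.
Qed.

Lemma int_lt1_eq0 (t : rat) : t \in Num.int -> `|t| < 1 -> t = 0.
Proof.
move=> /intrP[a ->]; rewrite -intr_norm (_ : 1 = 1%:~R)// ltr_int -[1]add0r ltzD1.
by rewrite normr_le0 => /eqP ->.
Qed.

Lemma Qp_of_ratM r t : ofQ (r * t) = ofQ r * ofQ t.
Proof.
rewrite /Qp_of_rat -Qp_piM; congr (\pi_(_) _)%qT.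
by apply: val_inj; apply/funext.
Qed.

Lemma Qp_of_rat0 : ofQ 0 = 0.
Proof. by rewrite -[0 in LHS](subrr 0) Qp_of_ratB subrr. Qed.

Lemma Qp_of_ratN r : ofQ (- r) = - ofQ r.
Proof. by rewrite -[- r]sub0r Qp_of_ratB Qp_of_rat0 sub0r. Qed.

Lemma Qp_of_ratD r t : ofQ (r + t) = ofQ r + ofQ t.
Proof. by rewrite -{1}[t]opprK Qp_of_ratB Qp_of_ratN opprK. Qed.

Lemma Qp_normM x y : Qp_norm (x * y) = Qp_norm x * Qp_norm y.
Proof.
have [->|x0] := eqVneq x 0; first by rewrite !mul0r Qp_norm0 mul0r.
have [->|y0] := eqVneq y 0; first by rewrite !mulr0 Qp_norm0 mulr0.
have [nx [N xN]] := Qp_normE x0; have [ny [M yM]] := Qp_normE y0.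
rewrite -{1}[x]reprK -{1}[y]reprK -Qp_piM; apply: Qp_norm_pi.
  by rewrite gt_eqF// mulr_gt0.
exists (maxn N M) => i; rewrite geq_max => /andP[Ni Mi].
by rewrite -(xN i Ni) -(yM i Mi) -padic_absM.
Qed.

Lemma Qp_normB_le x y r : Qp_norm x <= r -> Qp_norm y <= r -> Qp_norm (x - y) <= r.
Proof.
by move=> xr yr; apply: le_trans (Qp_norm_ultra _ _) _; rewrite Qp_normN ge_max xr.
Qed.

Lemma Qp_normD_le x y r : Qp_norm x <= r -> Qp_norm y <= r -> Qp_norm (x + y) <= r.
Proof. by move=> xr yr; apply: le_trans (Qp_norm_ultra _ _) _; rewrite ge_max xr. Qed.

Lemma Qp_norm_pz s : Qp_norm (ofQ (p%:R ^ (- s))) = p%:R ^ s.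
Proof. by rewrite Qp_norm_rat padic_absX opprK. Qed.

(** Multiplying by [p^s] turns the required precision into 1, which the fractional part achieves;
    dividing by [p^s] scales the error back. *)
Lemma fracp_rat_approx x s : exists2 r, (exists k, p%:R ^+ k * r \in Num.int) /\
  0 <= r < 1 & Qp_norm (x - ofQ (p%:R ^ (- s) * r)) <= p%:R ^ s.
Proof.
pose y := ofQ (p%:R ^ s) * x.
have -> : x = ofQ (p%:R ^ (- s)) * y.
  rewrite mulrA -Qp_of_ratM -expfzDr ?natp_neq0// addNr expr0z.
  rewrite -[LHS]mul1r; congr (_ * _).
  by rewrite /Qp_of_rat -Qp_pi1; congr (\pi_(_) _)%qT; exact: val_inj.
have [r01 rk yr] := fracpP y; exists (fracp y) => //.
rewrite Qp_of_ratM -mulrBr Qp_normM Qp_norm_pz.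
exact: ler_piMr (pz_ge0 _) yr.
Qed.

(* Coset representatives of the ball of radius p^s in that of radius p^(s+m). *)
Definition Qp_rep s m (c : nat) : Qp := ofQ (c%:R * p%:R ^ (- (s + m%:Z))).

Lemma Qp_rep_norm s (m : nat) c : Qp_norm (Qp_rep s m c) <= p%:R ^ (s + m).
Proof.
rewrite Qp_norm_rat padic_absM// padic_absX opprK ler_piMl ?pz_ge0//.
exact: (padic_abs_int p_pr c%:Z).
Qed.

(** The approximation [p^(-s) * r] of [x] again has norm at most [p^(s+m)] by the ultrametric
    inequality. Hence [p^m * r] is an integer in [[0, p^m[], and it is the index sought. *)
Lemma Qp_rep_exists s (m : nat) x : Qp_norm x <= p%:R ^ (s + m) ->
  exists c : 'I_(p ^ m), Qp_norm (x - Qp_rep s m c) <= p%:R ^ s.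
Proof.
move=> xm; have [r [[k rk] /andP[r0 r1]] xr] := fracp_rat_approx x s.
have pm0 : p%:R ^+ m != 0 :> rat by rewrite expf_neq0// natp_neq0.
have /intrP[a aE] : p%:R ^+ m * r \in Num.int.
  apply: padic_int_int.
    by exists k; rewrite mulrCA rpredM// rpredX// natr_int.
  rewrite padic_absM// exprnP padic_absX.
  have : Qp_norm (ofQ (p%:R ^ (- s) * r)) <= p%:R ^ (s + m).
    rewrite -[ofQ _](subKr x) Qp_normB_le// (le_trans xr)//.
    by rewrite ler_pz// lerDl.
  rewrite Qp_norm_rat padic_absM// padic_absX opprK.
  rewrite expfzDr ?natp_neq0// ler_pM2l ?pz_gt0// => H.
  rewrite -invr_expz mulrC ler_pdivrMr ?pz_gt0 ?mul1r//.
have a0 : 0 <= a by rewrite -(ler0z rat) -aE mulr_ge0// exprn_ge0// ltW// natp_gt0.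
move: a0 aE; case: a => // a _ aE.
have am : (a < p ^ m)%N.
  rewrite -(ltr_nat rat) natrX -[ltLHS]/(a%:Z%:~R) -aE gtr_pMr//.
  by rewrite exprn_gt0// natp_gt0.
exists (Ordinal am) => /=; rewrite /Qp_rep -[a%:R]/(a%:Z%:~R) -aE.
rewrite opprD expfzDr ?natp_neq0// -exprnN.
rewrite (_ : _ * _ * _ = p%:R ^ (- s) * r)//.
by rewrite mulrCA mulrAC divff// mul1r.
Qed.

(** [(c - d) / p^m] is p-adically integral with a power of [p] as denominator, hence an integer, and
    its absolute value is below 1. *)
Lemma Qp_rep_inj s (m : nat) (c d : 'I_(p ^ m)) :
  Qp_norm (Qp_rep s m c - Qp_rep s m d) <= p%:R ^ s -> c = d.
Proof.
have pm0 : 0 < p%:R ^+ m :> rat by rewrite exprn_gt0// natp_gt0.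
rewrite -Qp_of_ratB Qp_norm_rat -mulrBl padic_absM// padic_absX opprK.
rewrite expfzDr ?natp_neq0// mulrCA -ler_pdivlMl ?pz_gt0// mulVf ?gt_eqF ?pz_gt0// => H.
have /int_lt1_eq0 : (c%:R - d%:R) / p%:R ^+ m \in @Num.int rat.
  apply: padic_int_int.
    exists m; rewrite mulrC divfK ?gt_eqF//.
    by rewrite rpredB// natr_int.
  by rewrite padic_absM// padic_absV// exprnP padic_absX -invr_expz invrK.
have cm (e : 'I_(p ^ m)) : e%:R < p%:R ^+ m :> rat.
  by rewrite -natrX ltr_nat.
have c1 := cm c; have d1 := cm d.
have c0 : 0 <= c%:R :> rat by []. have d0 : 0 <= d%:R :> rat by [].
rewrite normrM normfV (gtr0_norm pm0) ltr_pdivrMr// mul1r ltr_norml => E.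
have /eqP := E ltac:(apply/andP; split; lra).
rewrite mulf_eq0 invr_eq0 (gt_eqF pm0) orbF subr_eq0 eqr_nat => /eqP.
exact: val_inj.
Qed.

(** The difference has a power of [p] as denominator, and it is p-adically integral because [x], [y]
    and [x + y] each differ from their fractional part by a p-adic integer. *)
Lemma fracpD x y : fracp (x + y) - (fracp x + fracp y) \in Num.int.
Proof.
have [_ [i xi] xn] := fracpP x; have [_ [j yj] yn] := fracpP y.
have [_ [k zk] zn] := fracpP (x + y).
apply: padic_int_int.
  exists (i + j + k)%N; rewrite mulrBr mulrDr.
  have -> : p%:R ^+ (i + j + k) * fracp (x + y)
          = p%:R ^+ (i + j) * (p%:R ^+ k * fracp (x + y)) by rewrite !exprD; ring.
  have -> : p%:R ^+ (i + j + k) * fracp x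
          = p%:R ^+ (j + k) * (p%:R ^+ i * fracp x) by rewrite !exprD; ring.
  have -> : p%:R ^+ (i + j + k) * fracp y
          = p%:R ^+ (i + k) * (p%:R ^+ j * fracp y) by rewrite !exprD; ring.
  by rewrite rpredB ?rpredD// rpredM// rpredX// natr_int.
rewrite -(Qp_norm_rat p_pr) Qp_of_ratB Qp_of_ratD.
have -> : ofQ (fracp (x + y)) - (ofQ (fracp x) + ofQ (fracp y)) =
  (x - ofQ (fracp x)) + (y - ofQ (fracp y)) - (x + y - ofQ (fracp (x + y))) by ring.
by apply: Qp_normB_le => //; exact: Qp_normD_le.
Qed.

Lemma fracp_eq0 x : (fracp x == 0) = (Qp_norm x <= 1).
Proof.
have [/andP[x0 x1] [i xi] xn] := fracpP x; apply/idP/idP => [/eqP f0|n1].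
  by move: xn; rewrite f0 Qp_of_rat0 subr0.
apply/eqP/int_lt1_eq0; last by rewrite ger0_norm.
apply: padic_int_int; first by exists i.
by rewrite -(Qp_norm_rat p_pr) -[ofQ _](subKr x) Qp_normB_le.
Qed.

(** Replacing [x k] by a rational at distance at most [p^(-k)] gives a Cauchy sequence of rationals,
    whose class is the limit. *)
Lemma Qp_complete (x : nat -> Qp) :
  (forall k l, (k <= l)%N -> Qp_norm (x l - x k) <= p%:R ^ (- k%:Z)) ->
  exists y, forall k, Qp_norm (y - x k) <= p%:R ^ (- k%:Z).
Proof.
move=> xc.
have /choice[r rx] k : exists r, Qp_norm (x k - ofQ r) <= p%:R ^ (- k%:Z).
  by have [r _] := fracp_rat_approx (x k) (- k%:Z); exists (p%:R ^ (- - k%:Z) * r).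
have rE k l : (k <= l)%N -> v (r l - r k) <= p%:R ^ (- k%:Z).
  move=> kl; rewrite -(Qp_norm_rat p_pr) Qp_of_ratB.
  have -> : ofQ (r l) - ofQ (r k) = (x l - x k) + (x k - ofQ (r k)) - (x l - ofQ (r l)).
    by ring.
  apply: Qp_normB_le; first exact: Qp_normD_le (xc _ _ kl) (rx k).
  by apply: le_trans (rx _) _; rewrite ler_pz// lerN2 lez_nat.
have rc : r \in padic_cauchy_pred p_pr.
  apply/asboolP => e e0; have [N Ne] := pz_small e0; exists N => i j Ni Nj.
  apply: le_lt_trans Ne.
  rewrite -(subrKA (r N)) (le_trans (padic_abs_ultra p_pr _ _))// ge_max rE//=.
  by rewrite -padic_absN// opprB rE.
exists (\pi_Qp (CauchySeq rc))%qT => k.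
rewrite -[X in Qp_norm X](subrKA (ofQ (r k))).
apply: Qp_normD_le; last by rewrite -Qp_normN opprB.
rewrite /Qp_of_rat -Qp_piN -Qp_piD.
set u := (_ + _)%R.
have uE i : u i = r i - r k by [].
(* When this difference is nonzero, its norm is the eventually constant value of [v (u i)], which
   can be read at an index beyond [k], where [rE] bounds it. *)
have [->|/negP] := eqVneq (\pi_Qp u : Qp)%qT 0; first by rewrite Qp_norm0 pz_ge0.
move=> u0; have {u0} nz : ~ padic_null p u by move=> /(Qp_eq0 u).
have [K uK] := padic_cauchy_abs p_pr (cauchy_seqP _) nz.
rewrite (@Qp_norm_pi _ _ _ (v (u K))).
- rewrite -(uK _ (leq_maxr k K)).1 uE rE// leq_maxl//.
- by rewrite padic_abs_eq0//; exact: (uK _ (leqnn K)).2.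
- by exists K => i /uK[].
Qed.

End QpArithmetic.

(** * Balls and test functions *)

(** The ball is a finite union of balls of radius [p^(-k)] for each [k], so an ultrafilter on it
    contains one of them; the centres converge by completeness, and the ultrafilter converges to
    their limit. *)
Lemma Qp_ball_compact (p : nat) (p_pr : prime p) (s : int) :
  compact [set x : Qp p_pr | Qp_norm x <= p%:R ^ s].
Proof.
rewrite compact_ultra => F UF Fs.
have meet A B : F A -> F B -> exists x, A x /\ B x.
  move=> FA FB; have /filter_ex[x [Ax Bx]] : F (A `&` B) by exact: filterI.
  by exists x.
have /choice[a aF] (k : nat) : exists a,
    F [set x | Qp_norm (x - a) <= p%:R ^ (- k%:Z)].
  (* Large enough for the cosets of exponent [- k] inside the ball of exponent [- k + m] to cover
     the given ball. *)
  pose m := absz (s + k%:Z).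
  have sm : s <= - k%:Z + m%:Z.
    by rewrite addrC lerBrDr /m abszE ler_norm.
  apply: contrapT => /forallNP nF.
  (* If the ultrafilter missed all the finitely many cosets, it would contain the intersection of
     their complements, which does not meet the ball. *)
  have /filter_ex[x [xs /= xn]] : F ([set x | Qp_norm x <= p%:R ^ s] `&`
      [set x | forall c : 'I_(p ^ m), ~ Qp_norm (x - Qp_rep p_pr (- k%:Z) m c)
                                        <= p%:R ^ (- k%:Z)]).
    apply: filterI => //; apply: filter_forall => c.
    by have [/nF|] := in_ultra_setVsetC [set x | Qp_norm (x -
      Qp_rep p_pr (- k%:Z) m c) <= p%:R ^ (- k%:Z)] UF.
  have [|c /xn//] := @Qp_rep_exists _ p_pr (- k%:Z) m x.
  by apply: le_trans xs _; exact: ler_pz.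
have [|y ya] := @Qp_complete p p_pr a.
  move=> k l kl; have [x /= [xk xl]] := meet _ _ (aF k) (aF l).
  rewrite (_ : a l - a k = (x - a k) - (x - a l)); last by ring.
  apply: Qp_normB_le => //; apply: le_trans xl _.
  by apply: ler_pz => //; rewrite lerN2 lez_nat.
have yF k : F [set x | Qp_norm (x - y) <= p%:R ^ (- k%:Z)].
  apply: filterS (aF k) => x /= xk.
  by rewrite (_ : x - y = (x - a k) - (y - a k)); [exact: Qp_normB_le|ring].
exists y; split => /=.
  have [k ks] := pz_small p_pr (pz_gt0 p_pr s).
  have [x /= [xs xk]] := meet _ _ Fs (yF k).
  rewrite -[y](subKr x); apply: Qp_normB_le => //.
  by apply: le_trans xk _; exact: ltW.
move=> A /nbhs_ballP[e /= e0 eA]; have [k ke] := pz_small p_pr e0.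
apply: filterS (yF k) => x /= xk; apply: eA; rewrite ballEmdist.
by apply: le_lt_trans ke; rewrite -[mdist _ _]/(Qp_norm _) -Qp_normN opprB.
Qed.

Section QpBalls.
Variables (p : nat) (p_pr : prime p) (n : nat).
Local Notation Qpn := 'rV[Qp p_pr]_n.
Implicit Types (x y h : Qpn) (s t : int) (A : set Qpn).

Definition qball s : set Qpn := [set x | forall j, Qp_norm (x 0 j) <= p%:R ^ s].

Lemma qball0 s : qball s 0.
Proof. by move=> j; rewrite mxE Qp_norm0 pz_ge0. Qed.

Lemma qballN s x : qball s x -> qball s (- x).
Proof. by move=> xs j; rewrite mxE Qp_normN. Qed.

Lemma qballD s x y : qball s x -> qball s y -> qball s (x + y).
Proof. by move=> xs ys j; rewrite mxE; exact: Qp_normD_le. Qed.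

Lemma qballB s x y : qball s x -> qball s y -> qball s (x - y).
Proof. by move=> xs ys; exact/qballD/qballN. Qed.

Lemma qballDr s x h : qball s h -> qball s (x + h) = qball s x.
Proof.
move=> hs; apply/propext; split=> [H|xs]; last exact: qballD.
by rewrite -[x](addrK h); exact: qballB.
Qed.

Lemma qballS s t : s <= t -> qball s `<=` qball t.
Proof. by move=> st x xs j; apply: le_trans (xs j) _; exact: ler_pz. Qed.

Lemma qball_exists x : exists k : nat, qball k%:Z x.
Proof.
have /choice[f fP] j : exists k : nat, Qp_norm (x 0 j) <= p%:R ^ k%:Z.
  exact: pz_large.
exists (\max_j f j) => j; apply: le_trans (fP j) _; apply: ler_pz => //.
by rewrite lez_nat leq_bigmax.
Qed.

Lemma nbhs_qballP x A :
  nbhs x A <-> exists k : nat, forall h, qball (- k%:Z) h -> A (x + h).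
Proof.
split=> [/nbhs_ballP[e /= e0 eA]|[k kA]].
  have [k ke] := pz_small p_pr e0; exists k => h hk; apply: eA.
  split=> // i j; rewrite ballEmdist ord1 /=.
  apply: le_lt_trans ke.
  by rewrite -[mdist _ _]/(Qp_norm _) !mxE opprD addNKr Qp_normN.
apply/nbhs_ballP; exists (p%:R ^ (- k%:Z)) => /=; first exact: pz_gt0.
move=> y [_ xy]; rewrite -(subrK x y) addrC; apply: kA => j.
have := xy 0 j; rewrite ballEmdist /= => /ltW.
by rewrite -[mdist _ _]/(Qp_norm _) -Qp_normN opprB !mxE.
Qed.

Lemma qball_invariant_open s A :
  (forall x h, qball s h -> A x -> A (x + h)) -> open A.
Proof.
move=> sA; rewrite openE => x Ax; apply/nbhs_qballP.
by exists (absz s) => h /qballS hs; apply: sA Ax; apply: hs; rewrite lerNl abszE -normrN ler_norm.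
Qed.

Lemma qball_compact s : compact (qball s).
Proof.
by apply: (@rV_compact (Qp p_pr) n (fun=> [set z | Qp_norm z <= p%:R ^ s])) => _;
  exact: Qp_ball_compact.
Qed.

Lemma qball_open s : open (qball s).
Proof. by apply: (@qball_invariant_open s) => x h /qballDr ->. Qed.

Lemma qball_closed s : closed (qball s).
Proof.
rewrite -openC; apply: (@qball_invariant_open s) => x h hs /=.
by rewrite qballDr.
Qed.

Definition qrep s (m : nat) (c : {ffun 'I_n -> 'I_(p ^ m)}) : Qpn :=
  \row_j Qp_rep p_pr s m (c j).

Lemma qrep_ball s (m : nat) c : qball (s + m%:Z) (qrep s (m := m) c).
Proof. by move=> j; rewrite mxE Qp_rep_norm. Qed.

Lemma qrep_exists s (m : nat) x : qball (s + m%:Z) x ->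
  exists c : {ffun 'I_n -> 'I_(p ^ m)}, qball s (x - qrep s c).
Proof.
move=> xm; have /choice[c cP] j := Qp_rep_exists (xm j).
by exists (finfun c) => j; rewrite !mxE ffunE.
Qed.

Lemma qrep_inj s (m : nat) (c d : {ffun 'I_n -> 'I_(p ^ m)}) x :
  qball s (x - qrep s c) -> qball s (x - qrep s d) -> c = d.
Proof.
move=> xc xd; apply/ffunP => j; apply: (@Qp_rep_inj _ p_pr s m).
have := qballB xd xc j; rewrite !mxE.
by rewrite opprB addrC subrKA.
Qed.

Variable V : zmodType.

(** A single exponent bounds both the support and the scale of invariance, so that the condition is
    monotone in [k]. The codomain is abstract because real functions such as [Re], [Im] and powers
    of the modulus are treated alongside complex ones. *)
Definition tame (k : nat) (f : Qpn -> V) :=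
  (forall x, ~ qball k%:Z x -> f x = 0) /\
  (forall x h, qball (- k%:Z) h -> f (x + h) = f x).

Lemma tameW k l f : (k <= l)%N -> tame k f -> tame l f.
Proof.
move=> kl [f0 fk]; split=> [x xl|x h hl].
  by apply: f0 => /(qballS (t := l%:Z)) H; apply/xl/H; rewrite lez_nat.
by apply: fk; apply: qballS hl; rewrite lerN2 lez_nat.
Qed.

End QpBalls.

Arguments qball {p} p_pr n s.

Section TestFunctions.
Variables (R : realType) (p : nat) (p_pr : prime p) (n : nat).
Local Notation Qpn := 'rV[Qp p_pr]_n.
Local Notation C := R[i]%C.

Lemma test_functionsP (f : Qpn -> C) :
  test_functions f <-> exists k, tame k f.
Proof.
split=> [[lc cK]|[k [f0 fk]]]; last first.
  split=> [x|]; first by apply/nbhs_qballP; exists k => h; exact: fk.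
  apply: (subclosed_compact _ (@qball_compact p p_pr n k%:Z)).
    exact: closed_closure.
  apply: (@subset_trans _ (closure (qball p_pr n k%:Z))).
    by apply: closureS => x /= fx; apply: contrapT => /f0 /eqP; apply/negP.
  by have /closure_id <- := @qball_closed p p_pr n k%:Z.
pose P (k : nat) (x : Qpn) := qball p_pr n k%:Z x /\
  forall h, qball p_pr n (- k%:Z) h -> f (x + h) = f x.
(* Compactness in near-covering form, with the filter of large [k]: once [P k y] holds for [y] near
   each point and [k] large, a single [k] serves the whole closed support. *)
have /compact_near_coveringP/(_ nat (@nbhs _ _ \oo) P) := cK.
case=> [x _|k _ kP].
  have [k0 xk0] := qball_exists x.
  have /nbhs_qballP[k1 xk1] := lc x.
  exists ([set x' | qball p_pr n (- k1%:Z) (x' - x)],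
          [set k | (maxn k0 k1 <= k)%N]).
    split; last by exists (maxn k0 k1).
    by apply/nbhs_qballP; exists k1 => h; rewrite /= [x + h]addrC addrK.
  move=> [y k] /=; rewrite geq_max => -[yx /andP[k0k k1k]].
  rewrite -(subrK x y) addrC; set h := y - x; split.
    apply: qballD; first by apply: qballS xk0; rewrite lez_nat.
    by apply: qballS yx; rewrite lerNl (@le_trans _ _ 0)// oppr_le0.
  move=> h' h'k; rewrite -addrA xk1 ?(xk1 h)//; apply: qballD => //.
  by apply: qballS h'k; rewrite lerN2 lez_nat.
have {}kP x : closure [set x | f x != 0] x -> P k x by apply: kP => /=.
exists k; split=> [x xk|x h hk].
  have [//|/eqP fx] := pselect (f x = 0).
  by case: xk; apply: (kP x _).1; apply: subset_closure.
(* If [x] is outside the closed support but [x + h] is inside, invariance is applied at [x + h] with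
   [- h]; if both are outside, both values are 0. *)
have [/kP[_]|Kx] := pselect (closure [set x | f x != 0] x); first exact.
have [/kP[_]|Kxh] := pselect (closure [set x | f x != 0] (x + h)).
  by move=> /(_ _ (qballN hk)); rewrite addrK.
have E z : ~ closure [set x | f x != 0] z -> f z = 0.
  by move=> Kz; apply: contrapT => /eqP fz; apply: Kz; exact: subset_closure.
by rewrite !E.
Qed.

End TestFunctions.

(** * Characters *)

Section Characters.
Variable (R : realType).
Local Notation C := R[i]%C.

(** [chi xi x] unfolds to [e2pi] of a sum of fractional parts; its argument is rational, so that
    integrality of differences can be tested on it. *)
Definition e2pi (t : rat) : C :=
  (cos (2 * pi * ratr t : R) +i* sin (2 * pi * ratr t : R))%C.

Lemma e2piD t u : e2pi (t + u) = e2pi t * e2pi u.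
Proof.
rewrite /e2pi rmorphD/= mulrDr cosD sinD.
by apply/eqP; rewrite eq_complex /= eqxx /= addrC eqxx.
Qed.

Lemma e2pi_int (t : rat) : t \in Num.int -> e2pi t = 1.
Proof.
have H n : cos (2 * pi * n%:R : R) = 1 /\ sin (2 * pi * n%:R : R) = 0.
  have -> : 2 * pi * n%:R = 0 + (pi *+ 2) *+ n :> R.
    by rewrite add0r -[RHS]mulr_natr mulr_natl.
  by rewrite (periodicn (@cosD2pi R)) (periodicn (@sinD2pi R)) cos0 sin0.
move=> /intrP[a ->]; rewrite /e2pi ratr_int.
case: a => n; first by have [-> ->] := H n.
by rewrite NegzE mulrNz mulrN cosN sinN; have [-> ->] := H n.+1; rewrite oppr0.
Qed.

Lemma e2pi_eqmod t u : t - u \in Num.int -> e2pi t = e2pi u.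
Proof. by move=> tu; rewrite -(subrK u t) e2piD e2pi_int// mul1r. Qed.

(** With [a = pi * t] in []0, pi[], the equality [cos (2 a) = 1] would force [sin a = 0]. *)
Lemma e2pi_neq1 t : 0 < t < 1 -> e2pi t != 1.
Proof.
move=> /andP[t0 t1]; apply/negP => /eqP [] H _; move: H.
have -> : 2 * pi * ratr t = (pi * ratr t) *+ 2 :> R.
  by rewrite -[RHS]mulr_natl mulrA.
rewrite mulr2n cosD -!expr2.
have : 0 < sin (pi * ratr t : R).
  apply: sin_gt0_pi; rewrite mulr_gt0 ?pi_gt0 ?ltr0q//=.
  by rewrite gtr_pMr ?pi_gt0// -[1](rmorph1 (@ratr R)) ltr_rat.
have := cos2Dsin2 (pi * ratr t : R).
set c := cos _; set s := sin _ => cs s0 E.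
have : s ^+ 2 = 0 by move: cs E; rewrite !expr2; nra.
by move/eqP; rewrite expf_eq0/= gt_eqF.
Qed.

Variables (p : nat) (p_pr : prime p) (n : nat).
Local Notation Qpn := 'rV[Qp p_pr]_n.
Local Notation chi := (chi R (p_pr := p_pr) (n := n)).
Implicit Types (x y xi h : Qpn).

(** [fracp] is additive only modulo integers, which [e2pi] does not see. *)
Lemma chiDr xi x y : chi xi (x + y) = chi xi x * chi xi y.
Proof.
rewrite -[RHS]e2piD; apply: e2pi_eqmod.
rewrite -big_split -sumrB/=; apply: rpred_sum => j _.
by rewrite mxE mulrDr fracpD.
Qed.

Lemma chiC xi x : chi xi x = chi x xi.
Proof.
by rewrite /Defs.chi; under eq_bigr do rewrite mulrC.
Qed.

Lemma chiDl xi eta x : chi (xi + eta) x = chi xi x * chi eta x.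
Proof. by rewrite chiC chiDr ![chi x _]chiC. Qed.

(** Each [xi_j * h_j] has norm at most [p^s * p^(-s) = 1], so its fractional part vanishes. *)
Lemma chi_qball s xi h : qball p_pr n s xi -> qball p_pr n (- s) h -> chi xi h = 1.
Proof.
move=> xs hs; apply: e2pi_int; rewrite big1 ?rpred0// => j _; apply/eqP.
rewrite fracp_eq0 Qp_normM; have -> : 1 = p%:R ^ s * p%:R ^ (- s) :> rat.
  by rewrite -expfzDr ?natp_neq0// subrr.
by rewrite ler_pM ?Qp_norm_ge0.
Qed.

Lemma chi_nontrivial s xi : ~ qball p_pr n s xi ->
  exists2 h, qball p_pr n (- s) h & chi xi h != 1.
Proof.
move=> /existsNP[j /negP]; rewrite -ltNge => xj.
(* Some coordinate [j] of [xi] has norm above [p^s]. Placing at [j] an element of norm exactly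
   [p^(-s)] gives a product of norm above 1, hence a fractional part in []0, 1[]. *)
pose t : Qp p_pr := Qp_of_rat p_pr (p%:R ^ (- - s)).
have tn : Qp_norm t = p%:R ^ (- s) by exact: Qp_norm_pz.
pose h : Qpn := \row_i (if i == j then t else 0).
exists h => [i|].
  by rewrite mxE; case: ifP => _; rewrite ?tn// Qp_norm0 pz_ge0.
have -> : chi xi h = e2pi (fracp (xi 0 j * t)).
  rewrite /Defs.chi (bigD1 j)//= big1 ?addr0 ?mxE ?eqxx// => i ij.
  by apply/eqP; rewrite mxE (negPf ij) mulr0 fracp_eq0 Qp_norm0.
apply: e2pi_neq1; have [/andP[f0 ->] _ _] := fracpP (xi 0 j * t).
rewrite andbT lt_def f0 andbT fracp_eq0 -ltNge Qp_normM tn.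
by rewrite -(@ltr_pM2r _ (p%:R ^ s)) ?pz_gt0// -mulrA -expfzDr ?natp_neq0//
   addNr mulr1 mul1r.
Qed.

End Characters.

(** * Haar measure *)

Section HaarMeasure.
Variables (R : realType) (p : nat) (p_pr : prime p) (n : nat).
Local Notation Qpn := 'rV[Qp p_pr]_n.
Local Notation B := (borelQp p_pr n).
Local Notation C := R[i]%C.
Local Notation qball := (qball p_pr n).
Implicit Types (x y h a : Qpn) (s : int) (k : nat).

Lemma borel_open (A : set Qpn) : open A -> measurable (A : set B).
Proof. by move=> oA; exact: sub_sigma_algebra. Qed.

(** Preimages under [f] are invariant under a ball, hence open. *)
Lemma invariant_measurable d (T : measurableType d) s (f : B -> T) :
  (forall x h, qball s h -> f (x + h : Qpn) = f x) -> measurable_fun [set: B] f.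
Proof.
move=> fs _ Y mY; rewrite setTI; apply: borel_open.
by apply: (@qball_invariant_open p p_pr n s) => x h hs /=; rewrite fs.
Qed.

Lemma measurable_translate a : measurable_fun [set: B] (fun x : B => a + x : B).
Proof.
apply: (@measurability _ _ B B setT _ (@open Qpn)) => //.
move=> _ [A oA <-]; rewrite setTI; apply: borel_open.
rewrite openE => x /= Ax; have /nbhs_qballP[k kA] : nbhs (a + x) A.
  exact: open_nbhs_nbhs.
by apply/nbhs_qballP; exists k => h hk /=; rewrite addrA; exact: kA.
Qed.

Lemma qball_measurable s : measurable (qball s : set B).
Proof. by apply: borel_open; exact: qball_open. Qed.

Variable mu : {measure set B -> \bar R}.
Hypothesis mu_haar : normalized_haar mu.
Local Open Scope ereal_scope.

Lemma haar_preimage a (A : set B) : measurable A ->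
  mu [set x : B | A (a + x : Qpn)%R] = mu A.
Proof.
move=> mA; rewrite -[RHS](mu_haar.2 (- a)%R A mA); congr (mu _).
apply/seteqP; split => [x /= Ax|_ [x Ax <-]/=]; last by rewrite addNKr.
by exists (a + x)%R => //; rewrite addKr.
Qed.

(** By invariance, the pushforward of [mu] under the translation is [mu] itself. *)
Lemma ge0_integral_translate a (f : B -> \bar R) : measurable_fun [set: B] f ->
  (forall x, 0 <= f x) -> \int[mu]_x f (a + x : Qpn)%R = \int[mu]_x f x.
Proof.
move=> mf f0; pose phi := fun x : B => (a + x : Qpn)%R : B.
have mphi : measurable_fun [set: B] phi by exact: measurable_translate.
have := @ge0_integral_pushforward _ _ _ _ R phi mphi mu setT f measurableT mf
  (fun y _ => f0 y).
rewrite preimage_setT => <-; apply: eq_measure_integral => A mA _.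
exact: haar_preimage.
Qed.

Lemma integral_translate a (f : B -> \bar R) : measurable_fun [set: B] f ->
  \int[mu]_x f (a + x : Qpn)%R = \int[mu]_x f x.
Proof.
move=> mf; rewrite integralE [RHS]integralE.
rewrite -(ge0_integral_translate a (measurable_funepos mf))//.
rewrite -(ge0_integral_translate a (measurable_funeneg mf))//.
by congr (_ - _); apply: eq_integral => x _; rewrite ?funeposE ?funenegE.
Qed.

(** The larger ball is the disjoint union of the [(p^m)^n] translates of the smaller one by the
    [qrep]. *)
Lemma haar_qballD s (m : nat) :
  mu (qball (s + m%:Z)) = (((p ^ m) ^ n)%N%:R)%:E * mu (qball s).
Proof.
pose I : finType := {ffun 'I_n -> 'I_(p ^ m)}.
pose F (i : 'I_#|I|) : set B :=
  [set x : B | qball s (- qrep p_pr s (enum_val i) + x)%R].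
have mF i : measurable (F i).
  apply: borel_open; apply: (@qball_invariant_open p p_pr n s) => x h hs.
  by rewrite /F /= addrA (qballDr _ hs).
have -> : qball (s + m%:Z) = \big[setU/set0]_(i < #|I|) F i.
  rewrite -bigcup_seq; apply/seteqP; split => [x xs|x [i _ xi]].
    have [c xc] := qrep_exists xs; exists (enum_rank c); first exact: mem_index_enum.
    by rewrite /F /= enum_rankK addrC.
  rewrite -[x](subrK (qrep p_pr s (enum_val i)))%R; apply: qballD.
    by move: xi; rewrite /F /= addrC; apply: qballS; rewrite lerDl.
  exact: qrep_ball.
rewrite measure_bigsetU_ord//; last first.
  move=> i j _ _ [x []]; rewrite /F /= ![(- _ + x)%R]addrC => xi xj.
  exact/enum_val_inj/(qrep_inj xi xj).
rewrite (eq_bigr (fun=> mu (qball s))) => [|i _]; last first.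
  by apply: haar_preimage; exact: qball_measurable.
rewrite big_const_ord iter_addr_0 card_ffun !card_ord.
by rewrite mule_natl.
Qed.

Lemma haar_qball s : mu (qball s) = ((((p ^ n)%N)%:R : R) ^ s)%R%:E.
Proof.
set q : R := (p ^ n)%N%:R.
have q0 : (0 < q)%R by rewrite ltr0n expn_gt0 prime_gt0.
have V0 : mu (qball 0) = 1 by rewrite -mu_haar.1; congr (mu _); rewrite /Defs.unit_ball -expr0z.
have qE m : (((p ^ m) ^ n)%N%:R = q ^+ m)%R by rewrite expnAC natrX.
case: s => k; first by have := haar_qballD 0 k; rewrite add0r V0 mule1 qE.
(* For a negative exponent the small ball is enlarged to the unit ball: its measure times a positive
   constant is 1, which excludes infinite values and determines it. *)
have := haar_qballD (Negz k) k.+1; rewrite NegzE addNr V0 qE -exprnN.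
case: (mu _) => [r| |] /=.
- by move=> [] E; congr EFin; apply/esym/mulr1_eq; rewrite -E.
- by rewrite gt0_muley ?lte_fin ?exprn_gt0.
- by rewrite gt0_muleNy ?lte_fin ?exprn_gt0.
Qed.

End HaarMeasure.

(** * Fourier transform *)

Section Fourier.
Variables (R : realType) (p : nat) (p_pr : prime p) (n : nat).
Local Notation Qpn := 'rV[Qp p_pr]_n.
Local Notation B := (borelQp p_pr n).
Local Notation C := R[i]%C.
Local Notation qball := (qball p_pr n).
Implicit Types (x y h a xi : Qpn) (s : int) (k l : nat).

Lemma tame_comp2 (U V W : zmodType) (phi : U -> V -> W) k
    (f : Qpn -> U) (g : Qpn -> V) : phi 0 0 = 0 ->
  tame k f -> tame k g -> tame k (fun x => phi (f x) (g x)).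
Proof.
move=> phi0 [f0 fk] [g0 gk]; split=> [x xk|x h hk]; first by rewrite f0// g0.
by rewrite fk// gk.
Qed.

Lemma tame_comp (U W : zmodType) (phi : U -> W) k (f : Qpn -> U) : phi 0 = 0 ->
  tame k f -> tame k (fun x => phi (f x)).
Proof.
by move=> phi0 [f0 fk]; split=> [x xk|x h hk]; [rewrite f0|rewrite fk].
Qed.

(** A tame function takes finitely many values: the ball of exponent [k] splits into cosets of the
    ball of exponent [- k], whence [k + k], and [f] is constant on each. *)
Lemma tame_rep (U : zmodType) k (f : Qpn -> U) x : tame k f -> qball k%:Z x ->
  exists2 c, qball (- k%:Z) (x - qrep p_pr (- k%:Z) (m := k + k) c) &
    f x = f (qrep p_pr (- k%:Z) c).
Proof.
move=> [_ fk] xk.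
have [|c xc] := @qrep_exists _ p_pr n (- k%:Z) (k + k) x; first by rewrite PoszD addKr.
by exists c => //; rewrite -(subrK (qrep p_pr (- k%:Z) c) x) addrC fk ?addrK.
Qed.

Lemma tame_bounded k (g : Qpn -> R) : tame k g -> exists M, forall x, `|g x| <= M.
Proof.
move=> gk; exists (\sum_c `|g (qrep p_pr (- k%:Z) (m := k + k) c)|) => x.
have [/(tame_rep gk)[c _ ->]|/gk.1 ->] := pselect (qball k%:Z x).
  by rewrite (bigD1 c)//= lerDl sumr_ge0.
by rewrite normr0 sumr_ge0.
Qed.

Lemma tame_measurable k (g : B -> R) : tame k g -> measurable_fun [set: B] g.
Proof. by move=> [_ gk]; exact: invariant_measurable gk. Qed.

Variable mu : {measure set B -> \bar R}.
Hypothesis mu_haar : normalized_haar mu.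

Lemma qball_lty s : (mu (qball s) < +oo)%E.
Proof. by rewrite haar_qball// ltry. Qed.

Lemma tame_integrable k (g : B -> R) : tame k g ->
  mu.-integrable [set: B] (EFin \o g).
Proof.
move=> gk; have [M gM] := tame_bounded gk.
have mb := @qball_measurable p p_pr n k%:Z.
have -> : EFin \o g = (EFin \o g) \_ (qball k%:Z : set B).
  apply/funext => x; rewrite patchE; case: ifPn => // /negP xk /=.
  by rewrite gk.1// => H; apply: xk; rewrite inE.
rewrite -integrable_mkcond//; apply: measurable_bounded_integrable => //.
- exact: qball_lty.
- by apply: measurable_funTS; exact: tame_measurable gk.
- by exists M; split; rewrite ?num_real// => r Mr x _ /=; apply: le_trans (gM x) (ltW Mr).
Qed.

Lemma tame_cmeasurable k (f : Qpn -> C) : tame k f -> cmeasurable f.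
Proof.
move=> fk; split.
- by apply: (@tame_measurable k); exact: (tame_comp (phi := @complex.Re R)).
- by apply: (@tame_measurable k); exact: (tame_comp (phi := @complex.Im R)).
Qed.

Lemma cintegralD k (f g : Qpn -> C) : tame k f -> tame k g ->
  cintegral mu (fun x => f x + g x) = cintegral mu f + cintegral mu g.
Proof.
move=> fk gk.
have I (phi : C -> R) (u : Qpn -> C) : phi 0 = 0 -> tame k u ->
    mu.-integrable [set: B] (EFin \o (fun x => phi (u x))).
  by move=> phi0 uk; apply: (@tame_integrable k); exact: tame_comp.
rewrite /cintegral; apply/eqP; rewrite eq_complex /=.
rewrite -!RintegralD//; try by [exact: I].
by apply/andP; split; apply/eqP; apply: eq_Rintegral => x _;
  case: (f x) (g x) => [? ?] [? ?].
Qed.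

Lemma cintegralZ k (c : C) (f : Qpn -> C) : tame k f ->
  cintegral mu (fun x => c * f x) = c * cintegral mu f.
Proof.
move=> fk; case: c => a b.
have I (phi : C -> R) : phi 0 = 0 ->
    mu.-integrable [set: B] (EFin \o (fun x => phi (f x))).
  by move=> phi0; apply: (@tame_integrable k); exact: tame_comp.
have IR := I _ (erefl : complex.Re (0 : C) = 0).
have II := I _ (erefl : complex.Im (0 : C) = 0).
rewrite /cintegral; apply/eqP; rewrite eq_complex /=.
have Z (u : R) (g : B -> R) : mu.-integrable [set: B] (EFin \o g) ->
    mu.-integrable [set: B] (EFin \o (fun x => u * g x)).
  by move=> ig; apply: (integrableZl _ u ig).
rewrite -!RintegralZl//= -RintegralB//; try exact: Z.
rewrite -RintegralD//; try exact: Z.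
by apply/andP; split; apply/eqP; apply: eq_Rintegral => x _; case: (f x).
Qed.

Lemma cintegral_translate a (f : Qpn -> C) : cmeasurable f ->
  cintegral mu (fun x => f (a + x)) = cintegral mu f.
Proof.
move=> [mR mI]; rewrite /cintegral /Rintegral.
have HR := @integral_translate R p p_pr n mu mu_haar a (fun x => (complex.Re (f x))%:E).
have HI := @integral_translate R p p_pr n mu mu_haar a (fun x => (complex.Im (f x))%:E).
by rewrite HR ?HI//; apply/measurable_EFinP.
Qed.

Local Notation chi := (chi R (p_pr := p_pr) (n := n)).

(** The exponent may grow, since [chi xi] is only known to be invariant under the ball dual to one
    containing [xi]. *)
Lemma tame_chiM k xi (f : Qpn -> C) : tame k f ->
  exists l, tame l (fun x => chi xi x * f x).
Proof.
move=> fk; have [l xl] := qball_exists xi; exists (maxn k l); split=> [x xk|x h hk].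
  by rewrite fk.1 ?mulr0// => H; apply: xk; apply: qballS H; rewrite lez_nat leq_maxl.
rewrite fk.2; last by apply: qballS hk; rewrite lerN2 lez_nat leq_maxl.
rewrite chiDr (chi_qball (h := h) _ xl) ?mulr1//.
by apply: qballS hk; rewrite lerN2 lez_nat leq_maxr.
Qed.

Lemma fourierD k l (f g : Qpn -> C) : tame k f -> tame l g ->
  fourier mu (fun x => f x + g x) = (fun xi => fourier mu f xi + fourier mu g xi).
Proof.
move=> fk gl; apply/funext => xi; rewrite /fourier.
have [k' fk'] := tame_chiM xi fk; have [l' gl'] := tame_chiM xi gl.
rewrite -(cintegralD (tameW (leq_maxl k' l') fk') (tameW (leq_maxr k' l') gl')).
by congr cintegral; apply/funext => x; rewrite mulrDr.
Qed.

Lemma fourierZ k c (f : Qpn -> C) : tame k f ->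
  fourier mu (fun x => c * f x) = (fun xi => c * fourier mu f xi).
Proof.
move=> fk; apply/funext => xi; rewrite /fourier.
have [k' fk'] := tame_chiM xi fk; rewrite -(cintegralZ _ fk').
by congr cintegral; apply/funext => x; rewrite mulrCA.
Qed.

(* Translating the integration variable by [h] multiplies the integral by [chi xi h]. *)
Lemma fourier_eq0 k (f : Qpn -> C) xi h : tame k f ->
  (forall x, f (x + h) = f x) -> chi xi h != 1 -> fourier mu f xi = 0.
Proof.
move=> fk fh xh; have [l fl] := tame_chiM xi fk.
have : fourier mu f xi = chi xi h * fourier mu f xi.
  rewrite {1}/fourier -(cintegral_translate h (tame_cmeasurable fl)).
  rewrite -(cintegralZ _ fl); congr cintegral; apply/funext => x.
  by rewrite chiDr addrC fh mulrA.
move/eqP; rewrite -subr_eq0 -[X in X - _]mul1r -mulrBl mulf_eq0 subr_eq0.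
by rewrite eq_sym (negPf xh) => /eqP.
Qed.

(** The two halves of [tame] are exchanged: invariance of [f] kills the transform at any [xi] whose
    character is nontrivial on the small ball, and the support of [f] lies where [chi h] is 1 for
    every [h] in the small ball. *)
Lemma fourier_tame k (f : Qpn -> C) : tame k f -> tame k (fourier mu f).
Proof.
move=> fk; split=> [xi /chi_nontrivial|xi h hk].
  by move=> /(_ R)[h hk xh]; apply: (fourier_eq0 fk _ xh) => x; exact: fk.2.
congr cintegral; apply/funext => x; rewrite chiDl.
have [xk|/fk.1 ->] := pselect (qball k%:Z x); last by rewrite !mulr0.
by rewrite (chi_qball _ hk) ?mulr1// opprK.
Qed.

Definition ball_ind s x : C := `[< qball s x >]%:R.

Lemma ball_ind1 s x : qball s x -> ball_ind s x = 1.
Proof. by move=> xs; rewrite /ball_ind asboolT. Qed.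

Lemma ball_ind0 s x : ~ qball s x -> ball_ind s x = 0.
Proof. by move=> xs; rewrite /ball_ind asboolF. Qed.

Lemma ball_indD s x h : qball s h -> ball_ind s (x + h) = ball_ind s x.
Proof. by move=> hs; rewrite /ball_ind qballDr. Qed.

Lemma ball_ind_tame s : tame `|s|%N (ball_ind s).
Proof.
split=> [x xs|x h hs].
  by apply: ball_ind0 => H; apply: xs; apply: qballS H; rewrite abszE ler_norm.
by apply: ball_indD; apply: qballS hs; rewrite lerNl abszE -normrN ler_norm.
Qed.

Local Notation q := ((p ^ n)%N%:R : R).

Lemma q_gt0 : 0 < q.
Proof. by rewrite ltr0n expn_gt0 prime_gt0. Qed.

(** On the dual ball the character is 1 on the support and the integral is the volume [q^s];
    elsewhere the character is nontrivial on the support and the integral vanishes. *)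
Lemma fourier_ball_ind s :
  fourier mu (ball_ind s) = (fun xi => ((q ^ s) +i* 0)%C * ball_ind (- s) xi).
Proof.
apply/funext => xi; have [xs|xs] := pselect (qball (- s) xi); last first.
  rewrite ball_ind0// mulr0; have [h hs xh] := chi_nontrivial R xs.
  rewrite opprK in hs.
  by apply: (fourier_eq0 (ball_ind_tame s) _ xh) => x; exact: ball_indD.
rewrite ball_ind1// mulr1 /fourier.
have -> : (fun x => chi xi x * ball_ind s x) =
          (fun x => (\1_(qball s : set B) (x : B) +i* 0)%C).
  apply/funext => x; rewrite indicE /ball_ind; have [H|H] := pselect (qball s x).
    rewrite asboolT// mem_set// (chi_qball _ xs) ?mulr1// opprK//.
  by rewrite asboolF// memNset// mulr0.
rewrite /cintegral /=; congr (_ +i* _)%C; last first.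
  by rewrite /Rintegral integral0.
rewrite /Rintegral integral_indic// ?setIT ?haar_qball//.
exact: qball_measurable.
Qed.

Lemma fourier_modulate a (f : Qpn -> C) :
  fourier mu (fun x => chi (- a) x * f x) = (fun xi => fourier mu f (xi - a)).
Proof.
apply/funext => xi; congr cintegral; apply/funext => x.
by rewrite chiDl mulrA.
Qed.

(** [f] is a finite combination of indicators of cosets of the ball of exponent [- k]. Each is a
    translate of a multiple of the transform of a ball indicator, and modulating before transforming
    produces the translation. *)
Lemma fourier_surj k (f : Qpn -> C) : tame k f ->
  exists l, exists2 g, tame l g & fourier mu g = f.
Proof.
move=> fk; pose I : finType := {ffun 'I_n -> 'I_(p ^ (k + k))}.
pose r (c : I) := qrep p_pr (- k%:Z) c.
have -> : f = (fun x => \sum_(c : I) f (r c) * ball_ind (- k%:Z) (x - r c)).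
  apply/funext => x; have [xk|xk] := pselect (qball k%:Z x).
    have [c xc ->] := tame_rep fk xk.
    rewrite (bigD1 c)//= ball_ind1// mulr1 big1 ?addr0// => d dc.
    rewrite ball_ind0 ?mulr0// => xd; move/eqP: dc; apply.
    exact: qrep_inj xd xc.
  rewrite fk.1// big1// => c _; rewrite ball_ind0 ?mulr0// => xc; apply: xk.
  rewrite -(subrK (r c) x); apply: qballD.
    by apply: qballS xc; rewrite lerNl (@le_trans _ _ 0)// oppr_le0.
  by have := qrep_ball p_pr (- k%:Z) c; rewrite PoszD addKr.
(* The exponent [l] is left existential because each modulation by [chi (- r c)] can enlarge it. *)
elim: (index_enum I) => [|c cs [l [g gl gE]]].
  exists 0%N, (fun=> 0); first by split.
  apply/funext => xi; rewrite big_nil /fourier /cintegral.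
  by under [X in (X +i* _)%C]eq_Rintegral do rewrite mulr0 /=;
     under [X in (_ +i* X)%C]eq_Rintegral do rewrite mulr0 /=;
     rewrite /Rintegral integral0.
have [m um] := tame_chiM (- r c) (ball_ind_tame k%:Z).
(* Cancels the volume [q^k] that [fourier_ball_ind] introduces. *)
pose z : C := (((q ^ k%:Z)^-1) +i* 0)%C.
exists (maxn m l), (fun x => f (r c) * z * (chi (- r c) x * ball_ind k%:Z x) + g x).
  apply: (tame_comp2 (phi := fun u v => f (r c) * z * u + v)).
  - by rewrite mulr0 addr0.
  - exact: tameW (leq_maxl _ _) um.
  - exact: tameW (leq_maxr _ _) gl.
rewrite (fourierD (tame_comp (phi := fun u => f (r c) * z * u) (mulr0 _) um) gl).
rewrite gE (fourierZ _ um) fourier_modulate fourier_ball_ind.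
apply/funext => xi; rewrite big_cons; congr (_ + _).
rewrite -!mulrA; congr (_ * _); rewrite mulrA.
rewrite (_ : z * _ = 1) ?mul1r//.
apply/eqP; rewrite eq_complex /= !mulr0 !mul0r subr0 addr0 mulVf ?eqxx//.
by rewrite gt_eqF// exprz_gt0// q_gt0.
Qed.

End Fourier.

(** * Approximation in the Lebesgue space *)

Section Density.
Variables (R : realType) (p : nat) (p_pr : prime p) (n : nat).
Local Notation Qpn := 'rV[Qp p_pr]_n.
Local Notation B := (borelQp p_pr n).
Local Notation C := R[i]%C.
Local Notation qball := (qball p_pr n).
Implicit Types (x y h a xi : Qpn) (s : int) (k l : nat) (f g : Qpn -> C) (c : C).

(** The norm of [R[i]] takes values in [R[i]]; this real form is the integrand of [cnorm]. *)
Definition cabs c : R := complex.Re `|c|.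

Lemma cabsE c : cabs c = Num.sqrt (complex.Re c ^+ 2 + complex.Im c ^+ 2).
Proof. by rewrite /cabs normc_def. Qed.

Lemma cabs_ge0 c : 0 <= cabs c.
Proof. by rewrite cabsE sqrtr_ge0. Qed.

Lemma cabs0 : cabs 0 = 0.
Proof. by rewrite /cabs normr0. Qed.

Lemma cabsD c d : cabs (c + d) <= cabs c + cabs d.
Proof. by have := ler_normD c d; rewrite lecE => /andP[]. Qed.

Lemma cabsM c d : cabs (c * d) = cabs c * cabs d.
Proof. by rewrite /cabs normrM !normc_def /= mulr0 subr0. Qed.

Lemma cabs_real (r : R) : cabs (r +i* 0)%C = `|r|.
Proof. by rewrite cabsE /= expr0n addr0 sqrtr_sqr. Qed.

Lemma Re_le_cabs c : `|complex.Re c| <= cabs c.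
Proof. by rewrite cabsE -sqrtr_sqr ler_sqrt ?addr_ge0 ?sqr_ge0// lerDl sqr_ge0. Qed.

Lemma Im_le_cabs c : `|complex.Im c| <= cabs c.
Proof. by rewrite cabsE -sqrtr_sqr ler_sqrt ?addr_ge0 ?sqr_ge0// lerDr sqr_ge0. Qed.

Lemma cmeasurableD f g : cmeasurable f -> cmeasurable g ->
  cmeasurable (fun x => f x + g x).
Proof.
move=> [fR fI] [gR gI]; split.
- rewrite (_ : (fun _ => _) = (fun x : B => complex.Re (f x) + complex.Re (g x))).
    exact: measurable_funD.
  by apply/funext => x; rewrite raddfD.
- rewrite (_ : (fun _ => _) = (fun x : B => complex.Im (f x) + complex.Im (g x))).
    exact: measurable_funD.
  by apply/funext => x; rewrite raddfD.
Qed.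

Lemma cmeasurableZ c f : cmeasurable f -> cmeasurable (fun x => c * f x).
Proof.
move=> [fR fI]; case: c => a b; split.
- rewrite (_ : (fun _ => _) = (fun x : B => a * complex.Re (f x) - b * complex.Im (f x))).
    by apply: measurable_funB; apply: measurable_funM => //; exact: measurable_cst.
  by apply/funext => x; case: (f x).
- rewrite (_ : (fun _ => _) = (fun x : B => a * complex.Im (f x) + b * complex.Re (f x))).
    by apply: measurable_funD; apply: measurable_funM => //; exact: measurable_cst.
  by apply/funext => x; case: (f x).
Qed.

Definition creal (u : B -> R) : Qpn -> C := fun x => (u x +i* 0)%C.

Lemma cmeasurable_real (u : B -> R) : measurable_fun [set: B] u ->
  cmeasurable (creal u).
Proof. by move=> mu; split=> //; exact: measurable_cst. Qed.

Lemma cabs_measurable f : cmeasurable f ->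
  measurable_fun [set: B] (fun x : B => cabs (f x)).
Proof.
move=> [fR fI]; under eq_fun do rewrite cabsE.
apply: measurableT_comp; first exact: continuous_measurable_fun (@sqrt_continuous R).
by apply: measurable_funD; exact: measurable_funX.
Qed.

Variable mu : {measure set B -> \bar R}.
Hypothesis mu_haar : normalized_haar mu.
Variable rho : R.
Hypothesis rho_gt1 : 1 < rho.

Lemma rho_gt0 : 0 < rho.
Proof. exact: lt_trans rho_gt1. Qed.

Local Hint Resolve rho_gt0 : core.

(** * Integrals of rho-th powers of the modulus *)

Definition rpow f : B -> \bar R := fun x => (cabs (f x) `^ rho)%:E.
(* The rho-th power of [cnorm]: the quasi-triangle inequality [IpowD] replaces
   Minkowski's inequality. *)
Definition Ipow f : \bar R := (\int[mu]_x rpow f x)%E.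

Lemma rpow_ge0 f x : (0 <= rpow f x)%E.
Proof. by rewrite lee_fin powR_ge0. Qed.

Lemma rpow_measurable f : cmeasurable f -> measurable_fun [set: B] (rpow f).
Proof.
move=> mf; apply/measurable_EFinP.
by apply: (measurableT_comp (measurable_powR _)); exact: cabs_measurable.
Qed.

Lemma Ipow_ge0 f : (0 <= Ipow f)%E.
Proof. by apply: integral_ge0 => x _; exact: rpow_ge0. Qed.

Lemma cnormE f : cnorm mu rho f = (Ipow f `^ rho^-1)%E.
Proof.
rewrite /cnorm Lnorm.unlock; apply: (congr1 (fun t => t `^ rho^-1)%E).
apply: eq_integral => x _.
by rewrite /rpow -[X in `|X|%E]/(cabs (f x))%:E abse_EFin ger0_norm ?cabs_ge0.
Qed.

Lemma cnorm_lty f : (cnorm mu rho f < +oo)%E = (Ipow f < +oo)%E.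
Proof.
rewrite cnormE; apply/idP/idP => [|]; last exact: poweR_lty.
by apply: lty_poweRy; rewrite invr_eq0 gt_eqF.
Qed.

Lemma cnorm_lt f (e : R) : 0 < e -> (Ipow f < (e `^ rho)%:E)%E ->
  (cnorm mu rho f < e%:E)%E.
Proof.
rewrite cnormE => e0; have := Ipow_ge0 f; case: (Ipow f) => [r| |]//.
rewrite lee_fin lte_fin poweR_EFin lte_fin => r0 re.
have rK : rho * rho^-1 = 1 by rewrite mulfV// gt_eqF.
rewrite -[ltRHS](powRr1 (ltW e0)) -rK powRrM.
by apply: gt0_ltr_powR; rewrite ?invr_gt0// nnegrE powR_ge0.
Qed.

Lemma Ipow_le f g : cmeasurable f -> cmeasurable g ->
  (forall x, cabs (f x) <= cabs (g x)) -> (Ipow f <= Ipow g)%E.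
Proof.
move=> mf mg fg; apply: ge0_le_integral => //.
- by move=> x _; exact: rpow_ge0.
- exact: rpow_measurable.
- exact: rpow_measurable.
- move=> x _; rewrite lee_fin; apply: ge0_ler_powR => //; rewrite ?nnegrE ?cabs_ge0//.
  exact: ltW.
Qed.

Lemma IpowZ c f : cmeasurable f ->
  Ipow (fun x => c * f x) = ((cabs c `^ rho)%:E * Ipow f)%E.
Proof.
move=> mf; rewrite /Ipow -ge0_integralZl//.
- by apply: eq_integral => x _; rewrite /rpow cabsM powRM ?cabs_ge0// EFinM.
- exact: rpow_measurable.
- by move=> x _; exact: rpow_ge0.
- by rewrite lee_fin powR_ge0.
Qed.

(** Pointwise, [(u + v)^rho <= (2 max(u, v))^rho <= 2^rho (u^rho + v^rho)]. *)
Lemma IpowD f g : cmeasurable f -> cmeasurable g ->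
  (Ipow (fun x => f x + g x)%R <= (2 `^ rho)%:E * (Ipow f + Ipow g))%E.
Proof.
move=> mf mg.
have rf := rpow_measurable mf; have rg := rpow_measurable mg.
have f0 (x : B) : [set: B] x -> (0 <= rpow f x)%E by move=> _; exact: rpow_ge0.
have g0 (x : B) : [set: B] x -> (0 <= rpow g x)%E by move=> _; exact: rpow_ge0.
rewrite /Ipow -ge0_integralD// -ge0_integralZl//; first last.
- by move=> x _; rewrite adde_ge0 ?rpow_ge0.
- exact: emeasurable_funD.
apply: ge0_le_integral => //.
- by move=> x _; exact: rpow_ge0.
- by apply: rpow_measurable; exact: cmeasurableD.
- by apply: measurable_funeM; exact: emeasurable_funD.
move=> x _; rewrite -EFinD -EFinM lee_fin.
set u := cabs (f x); set v := cabs (g x).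
have u0 : 0 <= u by exact: cabs_ge0. have v0 : 0 <= v by exact: cabs_ge0.
have m0 : 0 <= Num.max u v by rewrite le_max u0.
apply: (@le_trans _ _ ((2 * Num.max u v) `^ rho)).
  apply: ge0_ler_powR; rewrite ?nnegrE ?cabs_ge0 ?mulr_ge0//; first exact: ltW.
  apply: le_trans (cabsD _ _) _; rewrite mulr_natl mulr2n.
  by apply: lerD; rewrite le_max lexx ?orbT.
rewrite powRM// ler_pM2l ?powR_gt0//.
by rewrite /Num.max; case: ifP => _; rewrite ?lerDl ?lerDr powR_ge0.
Qed.

(** * Functions approximable by elements of [Phi] *)

Lemma Phi_tame f : Phi mu f -> exists2 k, tame k f & exists2 g, tame k g &
  g 0 = 0 /\ fourier mu g = f.
Proof.
move=> [g [/test_functionsP[k gk] g0] <-]; exists k; first exact: fourier_tame.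
by exists g.
Qed.

Lemma PhiD f g : Phi mu f -> Phi mu g -> Phi mu (fun x => f x + g x).
Proof.
move=> /Phi_tame[k _ [u uk [u0 <-]]] /Phi_tame[l _ [v vl [v0 <-]]].
exists (fun x => u x + v x); last exact: (fourierD mu_haar uk vl).
split; last by rewrite u0 v0 addr0.
apply/test_functionsP; exists (maxn k l).
apply: (tame_comp2 (phi := +%R)); first by rewrite addr0.
  exact: tameW (leq_maxl _ _) uk.
exact: tameW (leq_maxr _ _) vl.
Qed.

Lemma PhiZ c f : Phi mu f -> Phi mu (fun x => c * f x).
Proof.
move=> /Phi_tame[k _ [u uk [u0 <-]]].
exists (fun x => c * u x); last exact: (fourierZ mu_haar c uk).
split; last by rewrite u0 mulr0.
by apply/test_functionsP; exists k; exact: (tame_comp (mulr0 c) uk).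
Qed.

Lemma Phi_cmeasurable f : Phi mu f -> cmeasurable f.
Proof. by move=> /Phi_tame[k fk _]; exact: tame_cmeasurable fk. Qed.

(** Closeness is measured by [Ipow], so closure under sums and limits rests on [IpowD];
    measurability is carried along for the integral inequalities. *)
Definition approximable f := cmeasurable f /\
  forall e : R, 0 < e -> exists2 g, Phi mu g & (Ipow (fun x => f x - g x)%R < e%:E)%E.

Lemma cmeasurableB f g : cmeasurable f -> cmeasurable g ->
  cmeasurable (fun x => f x - g x).
Proof.
move=> mf mg; have := cmeasurableD mf (cmeasurableZ (- 1) mg).
by under eq_fun do rewrite mulN1r.
Qed.

(** The threshold absorbs both the two summands and the constant [2^rho] of [IpowD]. *)
Lemma IpowD_lt f g (e : R) : cmeasurable f -> cmeasurable g -> 0 < e ->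
  (Ipow f < (e / 2 / 2 `^ rho)%:E)%E -> (Ipow g < (e / 2 / 2 `^ rho)%:E)%E ->
  (Ipow (fun x => f x + g x)%R < e%:E)%E.
Proof.
move=> mf mg e0 fe ge; apply: le_lt_trans (IpowD mf mg) _.
have K0 : 0 < 2 `^ rho :> R by rewrite powR_gt0.
have -> : e = 2 `^ rho * (e / 2 / 2 `^ rho + e / 2 / 2 `^ rho).
  by field; rewrite gt_eqF.
by rewrite EFinM EFinD lte_pmul2l ?lte_fin//; exact: (lteD fe ge).
Qed.

Lemma approximable_limit f : cmeasurable f -> (forall e : R, 0 < e ->
    exists2 g, approximable g & (Ipow (fun x => f x - g x)%R < e%:E)%E) ->
  approximable f.
Proof.
move=> mf fA; split=> // e e0.
have e1 : 0 < e / 2 / 2 `^ rho by rewrite !divr_gt0// powR_gt0.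
have [g [mg gA] fg] := fA _ e1; have [h hP gh] := gA _ e1; exists h => //.
have := IpowD_lt (cmeasurableB mf mg) (cmeasurableB mg (Phi_cmeasurable hP)) e0 fg gh.
by under eq_fun do rewrite subrKA.
Qed.

Lemma approximableD f g : approximable f -> approximable g ->
  approximable (fun x => f x + g x).
Proof.
move=> [mf fA] [mg gA]; split=> [|e e0]; first exact: cmeasurableD.
have e1 : 0 < e / 2 / 2 `^ rho by rewrite !divr_gt0// powR_gt0.
have [u uP fu] := fA _ e1; have [v vP gv] := gA _ e1.
exists (fun x => u x + v x); first exact: PhiD.
have mu' := Phi_cmeasurable uP; have mv := Phi_cmeasurable vP.
have := IpowD_lt (cmeasurableB mf mu') (cmeasurableB mg mv) e0 fu gv.
by under eq_fun do rewrite addrACA -opprD.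
Qed.

Lemma approximableZ c f : approximable f -> approximable (fun x => c * f x).
Proof.
move=> [mf fA]; split=> [|e e0]; first exact: cmeasurableZ.
(* The added 1 keeps [K] positive when [c = 0], so that [e] can be divided by it. *)
pose K : R := cabs c `^ rho + 1.
have K0 : 0 < K by rewrite ltr_pwDr// powR_ge0.
have [u uP fu] := fA _ (divr_gt0 e0 K0).
exists (fun x => c * u x); first exact: PhiZ.
have mfu := cmeasurableB mf (Phi_cmeasurable uP).
under eq_fun do rewrite -mulrBr.
rewrite IpowZ//; apply: (@le_lt_trans _ _ (K%:E * Ipow (fun x => f x - u x)%R)%E).
  by rewrite lee_wpmul2r ?Ipow_ge0// lee_fin lerDl.
by rewrite -[e](mulfVK (lt0r_neq0 K0)) mulrC EFinM lte_pmul2l.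
Qed.

Lemma ereal_cvg0_lt (u : nat -> \bar R) (e : R) : 0 < e ->
  u @ \oo --> 0%E -> \forall i \near \oo, (u i < e%:E)%E.
Proof.
move=> e0 /fine_cvgP[ufin /cvgr0Pnorm_lt/(_ e e0)].
apply: filterS2 ufin => i ui; rewrite /= => H.
by rewrite -(fineK ui) lte_fin; apply: le_lt_trans H; rewrite ler_norm.
Qed.

Definition cind (S : set B) : Qpn -> C := creal \1_S.

Lemma cind_ball s : ball_ind R s = cind (qball s).
Proof.
apply/funext => x; rewrite /cind /creal indicE /ball_ind.
have [H|H] := pselect (qball s x); first by rewrite asboolT// mem_set.
by rewrite asboolF// memNset.
Qed.

Lemma cind_cmeasurable (S : set B) : measurable S -> cmeasurable (cind S).
Proof. by move=> mS; apply: cmeasurable_real; exact: measurable_indic. Qed.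

Lemma Ipow_cind (S : set B) : measurable S -> Ipow (cind S) = mu S.
Proof.
move=> mS; rewrite -[S in RHS]setIT -integral_indic//; apply: eq_integral => x _.
rewrite /rpow cabs_real indicE; case: (_ \in _).
  by rewrite normr1 powR1.
by rewrite normr0 powR0// gt_eqF.
Qed.

Lemma cindD (A S : set B) : S `<=` A ->
  (fun x => cind A x - cind S x) = cind (A `\` S).
Proof.
move=> SA; apply/funext => x; rewrite /cind /creal; apply/eqP.
rewrite eq_complex /= subrr eqxx andbT; apply/eqP; rewrite !indicE in_setD.
have [xS|xS] := boolP (x \in S); last by rewrite subr0 andbT.
by rewrite andbF mem_set ?subrr//; apply: SA; exact: set_mem.
Qed.

Lemma cind_tame k (S : set B) : S `<=` qball k%:Z ->
  (forall x h, qball (- k%:Z) h -> S x -> S (x + h : Qpn)) -> tame k (cind S).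
Proof.
move=> Sk Sh; split=> [x xk|x h hk]; rewrite /cind /creal !indicE.
  by rewrite memNset// => /Sk.
have -> // : ((x + h : Qpn) \in (S : set Qpn)) = (x \in (S : set Qpn)).
apply/idP/idP; rewrite !inE; last exact: Sh.
by move=> /(Sh _ _ (qballN hk)); rewrite addrK.
Qed.

(** * Tame functions and indicators of measurable sets *)

Hypothesis n_gt0 : (0 < n)%N.

Local Notation q := ((p ^ n)%N%:R : R).

Lemma q_gt1 : 1 < q.
Proof. by rewrite ltr1n -(exp1n n) ltn_exp2r// prime_gt1. Qed.

(* The correction [z 1_(B_m)] that makes the preimage vanish at 0 has norm
   O(q^(- m (1 - 1/rho))). *)
Lemma approximable_tame k f : tame k f -> approximable f.
Proof.
move=> fk; split=> [|e e0]; first exact: tame_cmeasurable fk.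
have [l [g gl gE]] := fourier_surj mu_haar fk.
have q1 := q_gt1; have q0 : 0 < q by exact: lt_trans q1.
(* The error will be exactly [(|g 0| q^(-m))^rho q^m = K t^m], and [t < 1] since [q > 1] and
   [rho > 1]. *)
pose t := q `^ (1 - rho); pose K := cabs (g 0) `^ rho.
have t1 : `|t| < 1.
  rewrite ger0_norm ?powR_ge0// /t /powR gt_eqF// expR_lt1.
  by rewrite pmulr_llt0 ?subr_lt0// ln_gt0.
have [m Km] : exists m : nat, K * t ^+ m < e.
  have /cvgr0Pnorm_lt/(_ e e0)[m _ /(_ m (leqnn m))] := cvg_geometric K t1.
  by rewrite /= => H; exists m; apply: le_lt_trans H; rewrite ler_norm.
pose z : C := ((q ^ (- m%:Z)) +i* 0)%C.
(* The ball of exponent [- m] contains 0, so [psi 0 = 0]; on the transform side the correction is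
   spread over the ball of exponent [m] with the small height [|g 0| q^(-m)]. *)
pose psi : Qpn -> C := fun x => g x + (- g 0) * ball_ind R (- m%:Z) x.
have bt := @ball_ind_tame R p p_pr n (- m%:Z).
have gbt := tame_comp (mulr0 (- g 0)) bt.
exists (fourier mu psi).
  exists psi => //; split; last first.
    by rewrite /psi ball_ind1 ?mulr1 ?subrr//; exact: qball0.
  apply/test_functionsP; exists (maxn l `|- m%:Z|%N).
  apply: (tame_comp2 (phi := +%R)); first by rewrite addr0.
    exact: tameW (leq_maxl _ _) gl.
  exact: tameW (leq_maxr _ _) gbt.
rewrite (fourierD mu_haar gl gbt) gE (fourierZ mu_haar _ bt).
rewrite (fourier_ball_ind mu_haar) opprK cind_ball.
have -> : (fun x => f x - (f x + - g 0 * ((q ^ (- m%:Z) +i* 0)%C * cind (qball m%:Z) x)))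
    = (fun x => g 0 * z * cind (qball m%:Z) x).
  by apply/funext => x; rewrite opprD addNKr mulNr opprK mulrA.
have mb := @qball_measurable p p_pr n m%:Z.
rewrite IpowZ ?Ipow_cind ?(haar_qball mu_haar)//; last exact: cind_cmeasurable.
rewrite -EFinM lte_fin cabsM cabs_real.
rewrite (ger0_norm (ltW (exprz_gt0 _ q0))) powRM ?cabs_ge0//.
rewrite -mulrA; move: Km; congr (_ * _ < _).
rewrite -!powR_intmul ?ltW// -powR_mulrn ?powR_ge0// -!powRrM -powRD.
  by congr (_ `^ _); rewrite mulrNz /=; ring.
by rewrite (gt_eqF q0) implybT.
Qed.

(** The differences with the union decrease to the empty set inside a ball of finite measure, so
    their measures, which are the [Ipow] of the errors, tend to 0. *)
Lemma approximable_bigcup k (S : nat -> set B) : (forall i, measurable (S i)) ->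
  (forall i, S i `<=` qball k%:Z) -> nondecreasing_seq S ->
  (forall i, approximable (cind (S i))) -> approximable (cind (\bigcup_i S i)).
Proof.
move=> mS Sk ndS SA; set T := \bigcup_i S i.
have mT : measurable T by exact: bigcup_measurable.
have TD i : measurable (T `\` S i) by exact: measurableD.
apply: approximable_limit => [|e e0]; first exact: cind_cmeasurable.
have TS0 : \bigcap_i (T `\` S i) = set0.
  rewrite -subset0 => x Tx; have [[i _ Six] _] := Tx 0%N I.
  by have [] := Tx i I.
have : (mu \o (fun i => T `\` S i)) @ \oo --> mu (\bigcap_i (T `\` S i)).
  apply: nonincreasing_cvg_mu => //.
  - apply: (@le_lt_trans _ _ (mu (qball k%:Z))); last by rewrite haar_qball// ltry.
    apply: le_measure; rewrite ?inE//; first exact: qball_measurable.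
    by move=> x [[i _ /Sk]].
  - exact: bigcap_measurable.
  - move=> i j ij; apply/subsetPset => x [Tx Sx]; split=> // /[dup] Six.
    by have /subsetPset := ndS _ _ ij => /[apply].
rewrite TS0 measure0 => /(ereal_cvg0_lt e0)[i _ /(_ i (leqnn i)) Si].
exists (cind (S i)); first exact: SA.
rewrite cindD; last by move=> x Sx; exists i.
by rewrite (Ipow_cind (TD i)); exact: Si.
Qed.

(** Truncating to balls keeps measures finite, as [approximable_bigcup] requires. The lambda-system
    asks for all truncations at once and is generated from the open sets. *)
Lemma approximable_ind k (S : set B) : measurable S ->
  approximable (cind (S `&` qball k%:Z)).
Proof.
pose H : set (set B) :=
  [set S : set B | measurable S /\ forall k, approximable (cind (S `&` qball k%:Z))].
have mb k' := @qball_measurable p p_pr n k'%:Z.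
suff : @measurable _ B `<=` H by move=> /[apply] -[_].
apply: (@lambda_system_subset _ (@open Qpn) (@openI _) setT); last by [].
- split; first by move=> A _ x _.
  + split; first exact: measurableT.
    move=> l; rewrite setTI -cind_ball.
    exact: approximable_tame (ball_ind_tame R _ _ _).
  + move=> A A' A'A [mA HA] [mA' HA']; split=> [|l]; first exact: measurableD.
    rewrite [X in cind X](_ : _ = (A `&` qball l%:Z) `\` (A' `&` qball l%:Z)).
      rewrite -cindD; last exact: setSI.
      have := approximableD (HA l) (approximableZ (- 1) (HA' l)).
      by under [X in approximable X -> _]eq_fun do rewrite mulN1r.
    apply/seteqP; split=> [x [[Ax A'x] xl]|x [[Ax xl] A'x]].
      by split=> // -[].
    by split=> //; split=> // A'x'; apply: A'x.
  + move=> F ndF HF; split=> [|l]; first by apply: bigcup_measurable => i _; exact: (HF i).1.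
    rewrite setI_bigcupl; apply: (@approximable_bigcup l).
    * by move=> i; apply: measurableI => //; exact: (HF i).1.
    * by move=> i x [].
    * by move=> i j /ndF /subsetPset Fij; apply/subsetPset; exact: setSI.
    * by move=> i; exact: (HF i).2.
- move=> O oO; split=> [|l]; first exact: borel_open.
  pose F (i : nat) : set B := [set x : B | forall h, qball (- i%:Z) h -> O (x + h : Qpn)].
  have Fi i x h : qball (- i%:Z) h -> F i x -> F i (x + h : Qpn).
    by move=> hi Fx h' h'i; rewrite -addrA; apply: Fx; exact: qballD.
  have mF i : measurable (F i).
    by apply: borel_open; apply: (@qball_invariant_open p p_pr n (- i%:Z)) => x h; exact: Fi.
  have -> : O = \bigcup_i F i.
    apply/seteqP; split=> [x Ox|x [i _ /(_ 0)]]; last first.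
      by rewrite addr0; apply; exact: qball0.
    have /nbhs_qballP[i iO] : nbhs x O by exact: open_nbhs_nbhs.
    by exists i.
  rewrite setI_bigcupl; apply: (@approximable_bigcup l).
  + by move=> i; exact: measurableI.
  + by move=> i x [].
  + move=> i j ij; apply/subsetPset; apply: setSI => x Fx h hj; apply: Fx.
    by apply: qballS hj; rewrite lerN2 lez_nat.
  (* The truncation of [F i] lies in the ball of exponent [l] and is invariant under the ball of
     exponent [- i], also contained in the truncating ball after shrinking; one exponent above both
     [i] and [l] covers everything. *)
  + move=> i; apply: (@approximable_tame (maxn i l)); apply: cind_tame.
      by move=> x [_]; apply: qballS; rewrite lez_nat leq_maxr.
    move=> x h hil [Fx xl]; split.
      by apply: Fi => //; apply: qballS hil; rewrite lerN2 lez_nat leq_maxl.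
    apply: qballD => //; apply: qballS hil.
    by rewrite lerNl (@le_trans _ _ 0)// oppr_le0.
Qed.

Lemma approximable_sum (I : Type) (s : seq I) (F : I -> Qpn -> C) :
  (forall i, approximable (F i)) -> approximable (fun x => \sum_(i <- s) F i x).
Proof.
move=> FA; elim: s => [|i s IH].
  by apply: (@approximable_tame 0%N); split=> [x _|x h _]; rewrite !big_nil.
under eq_fun do rewrite big_cons.
exact: approximableD (FA i) IH.
Qed.

(** * Simple functions and dominated convergence *)

Import HBNNSimple.

Lemma approximable_simple k (u : {nnsfun B >-> R}) :
  approximable (fun x : Qpn => (u x * \1_(qball k%:Z) x +i* 0)%C).
Proof.
pose F (y : R) : Qpn -> C :=
  fun x => (y +i* 0)%C * cind (u @^-1` [set y] `&` qball k%:Z) x.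
have -> : (fun x : Qpn => (u x * \1_(qball k%:Z) x +i* 0)%C) =
    (fun x => \sum_(y <- fset_set (range u)) F y x).
  apply/funext => x; rewrite fimfunE fsbig_finite//= mulr_suml.
  have sumE (s : seq R) (G : R -> R) :
      ((\sum_(y <- s) G y) +i* 0)%C = \sum_(y <- s) (G y +i* 0)%C.
    exact: (rmorph_sum (@real_complex R)).
  rewrite sumE; apply: eq_bigr => y _; rewrite /F /cind /creal indicI /=.
  by apply/eqP; rewrite eq_complex /= !mulr0 !mul0r subr0 !addr0 mulrA !eqxx.
apply: approximable_sum => y; apply: approximableZ; apply: approximable_ind.
exact: measurable_sfunP.
Qed.

(** Truncated simple approximations from below converge pointwise to [u], with errors between 0 and
    [u]; hence [u^rho] dominates the rho-th powers of the errors. *)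
Lemma approximable_ge0 (u : B -> R) : measurable_fun [set: B] u ->
  (forall x, 0 <= u x) -> (Ipow (creal u) < +oo)%E ->
  approximable (creal u).
Proof.
move=> mu_ u0 Iu; have mEu : measurable_fun [set: B] (EFin \o u) by exact/measurable_EFinP.
pose g := nnsfun_approx measurableT mEu.
have gu x : (fun m => g m x) @ \oo --> u x.
  have := @cvg_nnsfun_approx _ _ _ _ measurableT _ mEu (fun x _ => u0 x) x I.
  by move=> /fine_cvgP[].
have g_le m x : g m x <= u x.
  rewrite -lee_fin nnsfun_approxE.
  exact: (@le_approx _ _ _ setT (EFin \o u) m x (fun x _ => u0 x) I).
(* The same index governs the simple approximation and the truncating ball; at a fixed point the
   truncation is eventually inactive. *)
pose h m : Qpn -> C := fun x => (g m x * \1_(qball m%:Z) x +i* 0)%C.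
have hA m : approximable (h m) by exact: approximable_simple.
pose f : Qpn -> C := fun x => (u x +i* 0)%C.
have mf : cmeasurable f by exact: cmeasurable_real.
have fhE m x : cabs (f x - h m x) = u x - g m x * \1_(qball m%:Z) x.
  have -> : f x - h m x = ((u x - g m x * \1_(qball m%:Z) x) +i* 0)%C.
    by apply/eqP; rewrite eq_complex /= subrr !eqxx.
  rewrite cabs_real ger0_norm// subr_ge0 indicE; case: (_ \in _).
    by rewrite mulr1.
  by rewrite mulr0.
have fh_lt x (d : R) : 0 < d -> \forall m \near \oo, cabs (f x - h m x) < d.
  move=> d0; have /cvgrPdist_lt/(_ d d0) := gu x.
  have [k xk] := qball_exists x.
  have : \forall m \near \oo, (k <= m)%N by exists k.
  apply: filterS2 => m km H; rewrite fhE indicE mem_set ?mulr1.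
    by apply: le_lt_trans H; rewrite ler_norm.
  by apply: qballS xk; rewrite lez_nat.
have mfh m : cmeasurable (fun x => f x - h m x) by exact: cmeasurableB mf (hA m).1.
(* Applied to the powers [|f - h m|^rho], with limit 0 and dominating function [|f|^rho]; the
   convergence of the integrals is the conclusion kept. *)
have [|||||_ _] := @dominated_convergence _ B R mu setT measurableT
    (fun m => rpow (fun x => f x - h m x)) (cst 0%E) (rpow f).
- by move=> m; exact: rpow_measurable.
- exact: measurable_cst.
- apply: aeW => x _; apply: cvg_EFin; first exact: nearW.
  apply/cvgr0Pnorm_lt => e e0 /=.
  have := fh_lt x (e `^ rho^-1) (powR_gt0 _ e0); apply: filterS => m /= H.
  rewrite ger0_norm ?powR_ge0//.
  have rK : rho^-1 * rho = 1 by rewrite mulVf// gt_eqF.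
  rewrite -[ltRHS](powRr1 (ltW e0)) -rK powRrM.
  by apply: gt0_ltr_powR; rewrite ?nnegrE ?cabs_ge0 ?powR_ge0.
- apply/integrableP; split; first exact: rpow_measurable.
  rewrite (eq_integral (rpow f)); first exact: Iu.
  by move=> x _; rewrite gee0_abs// rpow_ge0.
- apply: aeW => x m _; rewrite gee0_abs ?rpow_ge0// lee_fin.
  apply: ge0_ler_powR; rewrite ?nnegrE ?cabs_ge0//; first exact: ltW.
  rewrite fhE cabs_real ger0_norm// gerBl mulr_ge0//.
rewrite integral0 => Ifh; apply: approximable_limit => // e e0.
have /(ereal_cvg0_lt e0)[m _ /(_ m (leqnn m)) Im] := Ifh.
by exists (h m); [exact: hA|exact: Im].
Qed.

(** The positive and negative parts are bounded by [|u|], so both have finite [Ipow]. *)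
Lemma approximable_real (u : B -> R) : measurable_fun [set: B] u ->
  (Ipow (creal u) < +oo)%E ->
  approximable (creal u).
Proof.
move=> mu_ Iu.
have part (v : B -> R) : measurable_fun [set: B] v -> (forall x, 0 <= v x <= `|u x|) ->
    approximable (creal v).
  move=> mv v0; apply: approximable_ge0; first exact: mv.
    by move=> x; have /andP[] := v0 x.
  apply: le_lt_trans Iu; apply: Ipow_le; [exact: cmeasurable_real..|].
  by move=> x; rewrite !cabs_real; have /andP[? ?] := v0 x; rewrite ger0_norm.
have up : approximable (fun x : Qpn => (Num.max (u x) 0 +i* 0)%C).
  apply: (part (fun x => Num.max (u x) 0)).
    by apply: measurable_maxr => //; exact: measurable_cst.
  by move=> x; rewrite le_max lexx orbT ge_max ler_norm normr_ge0.
have un : approximable (fun x : Qpn => (Num.max (- u x) 0 +i* 0)%C).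
  apply: (part (fun x => Num.max (- u x) 0)).
    apply: measurable_maxr; last exact: measurable_cst.
    exact: measurableT_comp.
  by move=> x; rewrite le_max lexx orbT ge_max -normrN ler_norm normr_ge0.
have := approximableD up (approximableZ (- 1) un).
congr approximable; apply/funext => x; rewrite mulN1r; apply/eqP.
rewrite eq_complex /= subrr eqxx andbT; apply/eqP.
have [u0|/ltW u0] := leP 0 (u x).
  by rewrite (max_idPr _) ?subr0// oppr_le0.
by rewrite (max_idPl _) ?sub0r ?opprK// oppr_ge0.
Qed.

Lemma approximable_cLspace f : cLspace mu rho f -> approximable f.
Proof.
move=> [mf]; rewrite cnorm_lty => If.
have [mR mI] := mf.
have R1 : approximable (fun x => (complex.Re (f x) +i* 0)%C).
  apply: (@approximable_real (fun x : B => complex.Re (f x))); first by [].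
  apply: le_lt_trans If; apply: Ipow_le; [exact: cmeasurable_real|exact: mf|].
  by move=> x; rewrite cabs_real; exact: Re_le_cabs.
have I1 : approximable (fun x => (complex.Im (f x) +i* 0)%C).
  apply: (@approximable_real (fun x : B => complex.Im (f x))); first by [].
  apply: le_lt_trans If; apply: Ipow_le; [exact: cmeasurable_real|exact: mf|].
  by move=> x; rewrite cabs_real; exact: Im_le_cabs.
have := approximableD R1 (approximableZ (0 +i* 1)%C I1).
congr approximable; apply/funext => x; apply/eqP; rewrite eq_complex /=.
by rewrite !mul0r !mulr0 !mul1r !subr0 !addr0 !add0r !eqxx.
Qed.

(** Since [rho > 0] gives [0^rho = 0], the function [|f|^rho] is itself tame, hence integrable. *)
Lemma tame_cLspace k f : tame k f -> cLspace mu rho f.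
Proof.
move=> fk; split; first exact: tame_cmeasurable fk.
rewrite cnorm_lty; apply: integrable_lty => //.
have t : tame k (fun x => cabs (f x) `^ rho).
  apply: (tame_comp (phi := fun c => cabs c `^ rho)) fk.
  by rewrite cabs0 powR0// gt_eqF.
exact: tame_integrable mu_haar _ _ t.
Qed.

End Density.

Theorem lemma3p4 (R : realType) (p : nat) (p_pr : prime p) (n : nat)
    (n_ge1 : (1 <= n)%N) (rho : R) (rho_gt1 : 1 < rho)
    (mu : {measure set (borelQp p_pr n) -> \bar R})
    (mu_haar : normalized_haar mu) :
  dense_in_cLspace mu rho (Phi mu).
Proof.
split=> [f /(Phi_tame mu_haar)[k fk _]|f fL e e0].
  exact: (tame_cLspace mu_haar rho_gt1 fk).
have [_ fA] := approximable_cLspace mu_haar rho_gt1 n_ge1 fL.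
(* Precision [e^rho] because [fA] controls the rho-th power of the norm. *)
have [g gP fg] := fA _ (powR_gt0 rho e0); exists g => //.
exact: (cnorm_lt rho_gt1 e0 fg).
Qed.
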